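(* Let $T>0$, $0<t_1<\dots<t_K<T$, $f:[0,T]\times\mathbb R^n\times\mathbb R^n\to\mathbb R^n$, $g:[0,T]\times\mathbb R^n\times\mathbb R\to\mathbb R$, $I_k:\mathbb R^n\to\mathbb R^n$ ($k=1,\dots,K$), $\varphi:(-\infty,0]\to\mathbb R^n$ and $\lambda>0$. Assume: (1) $f$ is continuous, and for every $M>0$ there is $L_1(M)\ge 0$ with $|f(t,u,v)-f(t,\bar u,\bar v)|\le L_1(M)(|u-\bar u|+|v-\bar v|)$ for all $t\in[0,T]$ and $u,\bar u,v,\bar v\in\mathbb R^n$ of norm at most $M$. (2) $g$ is continuous; $g(t,u,0)>0$ for all $t\in[0,T]$, $u\in\mathbb R^n$; and for every $M>0$ there is $L_2(M)\ge0$ with $|g(t,u,w)-g(t,\bar u,\bar w)|\le L_2(M)(|u-\bar u|+|w-\bar w|)$ for all $t\in[0,T]$, $u,\bar u\in\mathbb R^n$ of norm at most $M$, and $w,\bar w\in[-M,M]$. (3) There is $L_3\ge0$ with $|I_k(u)-I_k(\bar u)|\le L_3|u-\bar u|$ for all $u,\bar u\in\mathbb R^n$, $k=1,\dots,K$. (4) There is a strictly decreasing sequence $0=t_0>t_{-1}>t_{-2}>\cdots$ tending to $-\infty$ such that $\varphi$ can have jump discontinuities only at the points $t_{-k}$, is right-continuous at them, and for every $M>0$ there is $L_4(M)\ge0$ with $|\varphi(s)-\varphi(\bar s)|\le L_4(M)|s-\bar s|$ for all $s,\bar s\in[t_{-k-1},t_{-k})\cap[-M,0]$, $k\in\mathbb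 N_0$; moreover $\varphi$ is bounded on $(-\infty,0]$. Let $\alpha,h^*,M_1,M_2,M_3$ be admissible constants (defined in the context), and assume moreover that $$g(t,u,w)<1\qquad\text{for all } t\in[0,\alpha],\ u\in\mathbb R^n \text{ with } |u|\le M_1,\ w\in[0,M_1].$$ Then the impulsive initial value problem (P) (see the context) has a unique solution $(x,\tau)$ on $(-\infty,\alpha]$. Moreover, $$\tau(t)>0,\quad t\in[0,\alpha];\qquad |x(t)|+\tau(t)\le M_1,\quad t\in(-\infty,\alpha];$$ $$|x(t)-x(\bar t)|\le M_2|t-\bar t|,\quad t,\bar t\in\mathcal J_k,\ k=-\ell_0,\dots,k_0;$$ $$|\tau(t)-\tau(\bar t)|\le M_3|t-\bar t|,\quad t,\bar t\in[0,\alpha].$$ Here $k_0\in\{0,\dots,K\}$ is the largest index with $t_{k_0}<\alpha$, $\ell_0\in\mathbb N$ is the index with $-\lambda\in[t_{-\ell_0},t_{-\ell_0+1})$, and, after replacing $t_{-\ell_0}$ by $-\lambda$ and $t_{k_0+1}$ by $\alpha$, $\mathcal J_k=[t_k,t_{k+1})$ for $k=-\ell_0,\dots,k_0-1$ and $\mathcal J_{k_0}=[t_{k_0},\alpha]$.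
   Context: $|\cdot|$ is a fixed norm on $\mathbb R^n$; $\mathbb N_0=\{0,1,2,\dots\}$; $\mathcal T=\{t_1,\dots,t_K\}$ (possibly empty, i.e. $K=0$); $t_0=0$, $t_{K+1}=T$; $t_{-k}$ ($k\in\mathbb N_0$) is the sequence in hypothesis (4). $\mathcal I_k=[t_k,t_{k+1})$ for integers $k\le K-1$ and $\mathcal I_K=[t_K,T]$. $x(t-)$ is the left limit and $\Delta x(t)=x(t)-x(t-)$. Problem (P): $\dot x(t)=f(t,x(t),x(t-\tau(t)))$ for a.e. $t\ge 0$; $\dot\tau(t)=g(t,x(t),\tau(t))$ for a.e. $t\ge0$; $\Delta x(t_k)=I_k(x(t_k-))$, $k=1,\dots,K$; $x(t)=\varphi(t)$, $t\le0$; $\tau(t)=\lambda$, $t\le 0$. A solution of (P) on $(-\infty,\alpha]$ ($0<\alpha\le T$) is a pair $x:(-\infty,\alpha]\to\mathbb R^n$, $\tau:(-\infty,\alpha]\to\mathbb R$ such that $x$ is absolutely continuous on each $\mathcal I_k\cap[0,\alpha]$, $k=0,\dots,K$, right-continuous at the points $t_k\in\mathcal T\cap[0,\alpha]$; $\tau$ is continuous on $[0,\alpha]$ and continuously differentiable on $[0,\alpha]$ except at the points of $\mathcal T\cap[0,\alpha]$; and the relations of (P) hold (the differential equations a.e. on $[0,\alpha]$, the impulse conditions at all $t_k\le\alpha$). Scheme (P$_h$), $h>0$: with $[t]_h=\lfloor t/h\rfloor h$, $\dot x_h(t)=f([t]_h,x_h([t]_h),x_h([t]_h-[\tau_h([t]_h)]_h))$;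 $\dot\tau_h(t)=g([t]_h,x_h([t]_h),\tau_h([t]_h))$; $\Delta x_h(t_k)=I_k(x_h(t_k-))$, $k=1,\dots,K$; $x_h(t)=\varphi(t)$ and $\tau_h(t)=\lambda$ for $t\le0$. Derivatives are understood as right derivatives at points where the two-sided derivative need not exist (mesh points $jh$, impulse times). A solution of (P$_h$) on $(-\infty,\alpha]$ is a pair $(x_h,\tau_h)$ satisfying these relations for $t$ up to $\alpha$, with $\tau_h$ continuous on $[0,\alpha]$ and linear between consecutive points of $(\mathbb N_0h\cap[0,\alpha])\cup\{\alpha\}$; $x_h$ continuous on each $\mathcal I_k\cap[0,\alpha]$, $k=0,\dots,K$, linear between consecutive points of $(\mathbb N_0h\cap[0,\alpha])\cup\{\alpha\}\cup(\mathcal T\cap[0,\alpha])$, with finite left limits and right-continuous at each $t_k\in\mathcal T\cap[0,\alpha]$. Let $h_0=\min\{t_{k+1}-t_k: k=0,\dots,K\}$. Constants $\alpha,h^*,M_1,M_2,M_3$ are called admissible if $0<\alpha\le T$, $\alpha\notin\mathcal T$, $0<h^*\le h_0$, $M_1,M_2,M_3\ge0$, and for every $0<h<h^*$ the scheme (P$_h$) has a unique solution $(x_h,\tau_h)$ on $(-\infty,\alpha]$, and it satisfies: $\tau_h(t)>0$ for $t\in[0,\alpha]$; $|x_h(t)|+\tau_h(t)<M_1$ for $t\in(-\infty,\alpha]$; $|x_h(t)-x_h(\bar t)|\le M_2|t-\bar t|$ for $t,\bar t\in\mathcal I_k\cap[0,\alpha]$, $k=0,\dots,K$, and for $t,\bar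 t\in\mathcal I_{-k}\cap[-M_1,0]$, $k\in\mathbb N_0$; $|\tau_h(t)-\tau_h(\bar t)|\le M_3|t-\bar t|$ for $t,\bar t\in[0,\alpha]$. (Under hypotheses (1)–(4) and $\lambda>0$ admissible constants exist.) *)

(* Defs.v *)
From HB Require Import structures.
From mathcomp Require Import all_boot all_order all_algebra.
From mathcomp Require Import all_classical all_reals all_analysis.

Set Implicit Arguments.
Unset Strict Implicit.
Unset Printing Implicit Defensive.

Import Order.TTheory GRing.Theory Num.Theory.
Import numFieldNormedType.Exports.

Local Open Scope classical_set_scope.
Local Open Scope ring_scope.

(* Functions whose mathematical domain is a proper subset of R (such as
   (-oo, alpha], (-oo, 0] or [0, T]) are total functions here; every predicate
   below only depends on their values on the mathematical domain. *)

Definition is_norm (R : realType) (n : nat) (N : 'rV[R]_n -> R) : Prop :=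
  [/\ forall u v, N (u + v) <= N u + N v,
      forall a u, N (a *: u) = `|a| * N u
    & forall u, N u = 0 -> u = 0].

Definition abs_continuous_on (R : realType) (n : nat) (N : 'rV[R]_n -> R)
    (A : set R) (x : R -> 'rV[R]_n) : Prop :=
  forall e : R, 0 < e -> exists2 d : R, 0 < d &
    forall (m : nat) (a b : 'I_m -> R),
      (forall i, a i <= b i /\ `[a i, b i]%classic `<=` A) ->
      trivIset setT (fun i => `]a i, b i[%classic) ->
      \sum_i (b i - a i) < d ->
      \sum_i N (x (b i) - x (a i)) < e.

(* The derivative of f at s relative to A. *)
Definition derivative_within (R : realType) (V : normedModType R) (A : set R)
    (f : R -> V) (s : R) (d : V) : Prop :=
  (r - s)^-1 *: (f r - f s) @[r --> within (A `\ s) (nbhs s)] --> d.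

(* Continuous differentiability relative to A (one-sided at endpoints of A),
   except at the points of E. *)
Definition C1_except (R : realType) (A E : set R) (f : R -> R) : Prop :=
  exists2 df : R -> R,
    forall s : R, (A `\` E) s -> derivative_within A f s (df s)
    & {within A `\` E, continuous df}.

(* f is affine on [p, q) for any two consecutive points p < q of S; the right
   endpoint is left out because f may jump there. *)
Definition linear_between (R : realType) (V : lmodType R) (S : set R)
    (f : R -> V) : Prop :=
  forall p q : R, S p -> S q -> p < q ->
    (forall r, p < r < q -> ~ S r) ->
    exists c : V, forall s : R, p <= s < q -> f s = f p + (s - p) *: c.

Definition mesh_floor (R : realType) (h s : R) : R :=
  (Num.floor (s / h))%:~R * h.

Definition mesh (R : realType) (h : R) : set R :=
  [set s | exists j : nat, s = j%:R * h].

(* [t] is the bi-infinite sequence of knots: t 1, ..., t K are the impulse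
   times, t 0 = 0, t (K + 1) = T, and t (- k) for k >= 0 are the possible
   discontinuities of the initial function.  Indices above K + 1 are unused. *)
Definition knot_sequence (R : realType) (T : R) (K : nat) (t : int -> R)
    : Prop :=
  [/\ t 0 = 0, t K.+1%:Z = T,
      forall k : int, k <= K%:Z -> t k < t (k + 1)
    & t (- k%:Z) @[k --> \oo] --> -oo].

Definition impulse_times (R : realType) (K : nat) (t : int -> R) : set R :=
  [set s | exists2 k : nat, (1 <= k <= K)%N & s = t k%:Z].

Definition impulse_itv (R : realType) (T : R) (K : nat) (t : int -> R)
    (k : int) : set R :=
  if k < K%:Z then `[t k, t (k + 1)[%classic else `[t K%:Z, T]%classic.

Definition min_gap (R : realType) (K : nat) (t : int -> R) : R :=
  \big[Num.min/t 1 - t 0]_(k < K.+1) (t (k%:Z + 1) - t k%:Z).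

Definition hyp_f (R : realType) (n : nat) (N : 'rV[R]_n -> R) (T : R)
    (f : R -> 'rV[R]_n -> 'rV[R]_n -> 'rV[R]_n) : Prop :=
  {within [set p : R * 'rV[R]_n * 'rV[R]_n | 0 <= p.1.1 <= T],
     continuous (fun p => f p.1.1 p.1.2 p.2)} /\
  forall M : R, 0 < M -> exists2 L1 : R, 0 <= L1 &
    forall (s : R) (u u' v v' : 'rV[R]_n), 0 <= s <= T ->
      N u <= M -> N u' <= M -> N v <= M -> N v' <= M ->
      N (f s u v - f s u' v') <= L1 * (N (u - u') + N (v - v')).

Definition hyp_g (R : realType) (n : nat) (N : 'rV[R]_n -> R) (T : R)
    (g : R -> 'rV[R]_n -> R -> R) : Prop :=
  [/\ {within [set p : R * 'rV[R]_n * R | 0 <= p.1.1 <= T],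
         continuous (fun p => g p.1.1 p.1.2 p.2)},
      forall (s : R) (u : 'rV[R]_n), 0 <= s <= T -> 0 < g s u 0
    & forall M : R, 0 < M -> exists2 L2 : R, 0 <= L2 &
        forall (s : R) (u u' : 'rV[R]_n) (w w' : R), 0 <= s <= T ->
          N u <= M -> N u' <= M -> - M <= w <= M -> - M <= w' <= M ->
          `|g s u w - g s u' w'| <= L2 * (N (u - u') + `|w - w'|)].

Definition hyp_I (R : realType) (n : nat) (N : 'rV[R]_n -> R) (K : nat)
    (I : nat -> 'rV[R]_n -> 'rV[R]_n) : Prop :=
  exists2 L3 : R, 0 <= L3 &
    forall (k : nat) (u u' : 'rV[R]_n), (1 <= k <= K)%N ->
      N (I k u - I k u') <= L3 * N (u - u').

(* At t 0 = 0 only the left limit is required: right-continuity there is void,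
   phi being defined on (-oo, 0]. *)
Definition hyp_phi (R : realType) (n : nat) (N : 'rV[R]_n -> R)
    (t : int -> R) (phi : R -> 'rV[R]_n) : Prop :=
  [/\ forall s : R, s < 0 -> (forall k : nat, s <> t (- k%:Z)) ->
        {for s, continuous phi},
      forall k : nat, cvg (phi @ (t (- k%:Z))^'-),
      forall k : nat, (0 < k)%N ->
        phi @ (t (- k%:Z))^'+ --> phi (t (- k%:Z)),
      forall M : R, 0 < M -> exists2 L4 : R, 0 <= L4 &
        forall (k : nat) (s s' : R),
          t (- k%:Z - 1) <= s < t (- k%:Z) -> - M <= s <= 0 ->
          t (- k%:Z - 1) <= s' < t (- k%:Z) -> - M <= s' <= 0 ->
          N (phi s - phi s') <= L4 * `|s - s'|
    & exists B : R, forall s : R, s <= 0 -> N (phi s) <= B].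

(* Delta x (s) = J (x (s-)), including the existence of the left limit. *)
Definition impulse_at (R : realType) (n : nat) (x : R -> 'rV[R]_n) (s : R)
    (J : 'rV[R]_n -> 'rV[R]_n) : Prop :=
  cvg (x @ s^'-) /\ x s - lim (x @ s^'-) = J (lim (x @ s^'-)).

(* The inequality [s - tau s <= alpha] states that the delayed argument lies in
   the domain of x.  Right-continuity at t k = alpha is void, hence the strict
   inequality in [sol_rcont]. *)
Record solution (R : realType) (n : nat) (N : 'rV[R]_n -> R)
    (T : R) (K : nat) (t : int -> R)
    (f : R -> 'rV[R]_n -> 'rV[R]_n -> 'rV[R]_n) (g : R -> 'rV[R]_n -> R -> R)
    (I : nat -> 'rV[R]_n -> 'rV[R]_n) (phi : R -> 'rV[R]_n) (lambda alpha : R)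
    (x : R -> 'rV[R]_n) (tau : R -> R) : Prop := Solution {
  sol_ac : forall k : nat, (k <= K)%N ->
    abs_continuous_on N (impulse_itv T K t k%:Z `&` `[0, alpha]) x ;
  sol_rcont : forall k : nat, (1 <= k <= K)%N -> t k%:Z < alpha ->
    x @ (t k%:Z)^'+ --> x (t k%:Z) ;
  sol_tau_cont : {within `[0, alpha], continuous tau} ;
  sol_tau_C1 : C1_except `[0, alpha] (impulse_times K t) tau ;
  sol_x_eq : {ae lebesgue_measure, forall s : R, 0 <= s <= alpha ->
    s - tau s <= alpha /\ is_derive s 1 x (f s (x s) (x (s - tau s)))} ;
  sol_tau_eq : {ae lebesgue_measure, forall s : R, 0 <= s <= alpha ->
    is_derive s 1 tau (g s (x s) (tau s))} ;
  sol_impulse : forall k : nat, (1 <= k <= K)%N -> t k%:Z <= alpha ->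
    impulse_at x (t k%:Z) (I k) ;
  sol_x_init : forall s : R, s <= 0 -> x s = phi s ;
  sol_tau_init : forall s : R, s <= 0 -> tau s = lambda
}.

(* Two-sided derivative off S, right derivative at the points of S. *)
Definition scheme_derivative (R : realType) (V : normedModType R)
    (S : set R) (f : R -> V) (s : R) (d : V) : Prop :=
  (~ S s -> is_derive s 1 f d) /\
  (S s -> (r - s)^-1 *: (f r - f s) @[r --> s^'+] --> d).

(* At s = alpha there is no right derivative within (-oo, alpha], so the
   differential relations are imposed on [0, alpha). *)
Record scheme_solution (R : realType) (n : nat)
    (T : R) (K : nat) (t : int -> R)
    (f : R -> 'rV[R]_n -> 'rV[R]_n -> 'rV[R]_n) (g : R -> 'rV[R]_n -> R -> R)
    (I : nat -> 'rV[R]_n -> 'rV[R]_n) (phi : R -> 'rV[R]_n) (lambda alpha h : R)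
    (x : R -> 'rV[R]_n) (tau : R -> R) : Prop := SchemeSolution {
  sch_tau_cont : {within `[0, alpha], continuous tau} ;
  sch_tau_lin : linear_between ((mesh h `&` `[0, alpha]) `|` [set alpha])
    (tau : R -> R^o) ;
  sch_x_cont : forall k : nat, (k <= K)%N ->
    {within impulse_itv T K t k%:Z `&` `[0, alpha], continuous x} ;
  sch_x_lin : linear_between ((mesh h `&` `[0, alpha]) `|` [set alpha] `|`
    (impulse_times K t `&` `[0, alpha])) x ;
  sch_rcont : forall k : nat, (1 <= k <= K)%N -> t k%:Z < alpha ->
    x @ (t k%:Z)^'+ --> x (t k%:Z) ;
  sch_x_eq : forall s : R, 0 <= s < alpha ->
    let s_h := mesh_floor h s in
    let r_h := s_h - mesh_floor h (tau s_h) in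
    r_h <= alpha /\
    scheme_derivative (mesh h `|` impulse_times K t) x s
      (f s_h (x s_h) (x r_h)) ;
  sch_tau_eq : forall s : R, 0 <= s < alpha ->
    let s_h := mesh_floor h s in
    scheme_derivative (mesh h `|` impulse_times K t) tau s
      (g s_h (x s_h) (tau s_h)) ;
  sch_impulse : forall k : nat, (1 <= k <= K)%N -> t k%:Z <= alpha ->
    impulse_at x (t k%:Z) (I k) ;
  sch_x_init : forall s : R, s <= 0 -> x s = phi s ;
  sch_tau_init : forall s : R, s <= 0 -> tau s = lambda
}.

Definition unique_upto (R : realType) (V : Type) (alpha : R)
    (P : (R -> V) -> (R -> R) -> Prop) (x : R -> V) (tau : R -> R) : Prop :=
  P x tau /\
  forall y sigma, P y sigma ->
    forall s : R, s <= alpha -> y s = x s /\ sigma s = tau s.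

Definition admissible (R : realType) (n : nat) (N : 'rV[R]_n -> R)
    (T : R) (K : nat) (t : int -> R)
    (f : R -> 'rV[R]_n -> 'rV[R]_n -> 'rV[R]_n) (g : R -> 'rV[R]_n -> R -> R)
    (I : nat -> 'rV[R]_n -> 'rV[R]_n) (phi : R -> 'rV[R]_n)
    (lambda alpha hstar M1 M2 M3 : R) : Prop :=
  [/\ 0 < alpha <= T, ~ impulse_times K t alpha, 0 < hstar <= min_gap K t,
      [/\ 0 <= M1, 0 <= M2 & 0 <= M3] &
  forall h : R, 0 < h < hstar ->
    exists (x : R -> 'rV[R]_n) (tau : R -> R),
      unique_upto alpha (scheme_solution T K t f g I phi lambda alpha h) x tau
      /\ [/\
      forall s : R, 0 <= s <= alpha -> 0 < tau s,
      forall s : R, s <= alpha -> N (x s) + tau s < M1,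
      forall k : nat, (k <= K)%N -> forall s s' : R,
        (impulse_itv T K t k%:Z `&` `[0, alpha]) s ->
        (impulse_itv T K t k%:Z `&` `[0, alpha]) s' ->
        N (x s - x s') <= M2 * `|s - s'|,
      forall (k : nat) (s s' : R),
        (impulse_itv T K t (- k%:Z) `&` `[- M1, 0]) s ->
        (impulse_itv T K t (- k%:Z) `&` `[- M1, 0]) s' ->
        N (x s - x s') <= M2 * `|s - s'|
    & forall s s' : R, 0 <= s <= alpha -> 0 <= s' <= alpha ->
        `|tau s - tau s'| <= M3 * `|s - s'|]].

Definition last_knot_before (R : realType) (K : nat) (t : int -> R) (alpha : R)
    (k0 : nat) : Prop :=
  [/\ (k0 <= K)%N, t k0%:Z < alpha
    & forall k : nat, (k <= K)%N -> t k%:Z < alpha -> (k <= k0)%N].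

Definition history_index (R : realType) (t : int -> R) (lambda : R) (l0 : nat)
    : Prop :=
  t (- l0%:Z) <= - lambda < t (- l0%:Z + 1).

Definition modified_knot (R : realType) (t : int -> R) (lambda alpha : R)
    (k0 l0 : nat) (k : int) : R :=
  if k == - l0%:Z then - lambda else if k == k0%:Z + 1 then alpha else t k.

Definition J_itv (R : realType) (t : int -> R) (lambda alpha : R)
    (k0 l0 : nat) (k : int) : set R :=
  let s := modified_knot t lambda alpha k0 l0 in
  if k < k0%:Z then `[s k, s (k + 1)[%classic else `[s k0%:Z, alpha]%classic.

(* Main.v *)
Require Import Defs.
From HB Require Import structures.
From mathcomp Require Import all_boot all_order all_algebra.
From mathcomp Require Import all_classical all_reals all_analysis.
From mathcomp Require Import ring lra zify.
Import Order.TTheory GRing.Theory Num.Theory.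
Import numFieldNormedType.Exports.
Local Open Scope classical_set_scope.
Local Open Scope ring_scope.

(* Existence.  The scheme solutions are bounded and equi-Lipschitz between
   knots, so they converge pointwise along an ultrafilter refining h -> 0+, and
   their bounds pass to the limit (x, tau).  As g < 1, the delayed argument
   s - tau s is strictly increasing, so that outside a countable set of times s
   neither s nor s - tau s is a knot; at such a time the slopes of the schemes
   near s are close to the right-hand side of the equation, and the limit is
   differentiable with the expected derivative.
   Uniqueness.  If two solutions agree up to v, then just after v the bound
   g < 1 keeps both delayed arguments in one interval between knots, where x is
   Lipschitz, and the equations contract the difference of the solutions on a
   short interval after v.
   Both parts compare increments with derivatives: an absolutely continuous
   function with derivative at most C almost everywhere grows at most at
   rate C. *)

Set Implicit Arguments.
Unset Strict Implicit.
Unset Printing Implicit Defensive.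

(** * Increments of absolutely continuous functions *)

Section Neighborhoods.
Context {R : realType}.
Implicit Types (s : R) (P : set R).

(** The equations hold only almost everywhere and the schemes have only right derivatives at mesh
    points; bounding increments through right slopes ([slope_le]) treats both alike without
    integrals. Pointwise convergence is enough because every property of the limit is checked at
    finitely many times, for which a single small mesh size is chosen; the uniform Lipschitz bounds
    do the rest. The obstacle is [x (s - tau s)]: [x] jumps at impulse times and the initial
    function at its own knots, so the schemes are controlled near [s - tau s] only if it is no knot.
    If [s - tau s] were only weakly increasing, it could rest on a knot for a whole interval of
    times. In the uniqueness proof it matters that the intervals between knots are closed on the
    left: a delayed argument that never falls below its starting point stays for a while in the
    interval where it starts, even at a knot. Besides strict growth, two facts do not pass to the
    limit directly: positivity of the delay, recovered from [0 < g s u 0], and the jump relations,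
    recovered from a rate of convergence to left limits common to all schemes. *)

Lemma at_right_ex s P : (\forall r \near s^'+, P r) <->
  exists2 d : R, 0 < d & forall r, s < r < s + d -> P r.
Proof.
split=> [|[d d0 dP]].
  rewrite /at_right /within /= => /nbhs_ballP[d /= d0 dP].
  exists d => // r /andP[sr rd]; apply: dP => //.
  by rewrite /ball/= distrC gtr0_norm ?subr_gt0// ltrBlDl.
have sd : s < s + d by rewrite ltrDl.
near=> r; apply: dP; apply/andP; split; near: r.
  exact: nbhs_right_gt.
exact: nbhs_right_lt.
Unshelve. all: by end_near. Qed.

Lemma at_left_ex s P : (\forall r \near s^'-, P r) <->
  exists2 d : R, 0 < d & forall r, s - d < r < s -> P r.
Proof.
split=> [|[d d0 dP]].
  rewrite /at_left /within /= => /nbhs_ballP[d /= d0 dP].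
  exists d => // r /andP[sr rd]; apply: dP => //.
  by rewrite /ball/= gtr0_norm ?subr_gt0// ltrBlDl -ltrBlDr.
have sd : s - d < s by rewrite ltrBlDr ltrDl.
near=> r; apply: dP; apply/andP; split; near: r.
  exact: nbhs_left_gt.
exact: nbhs_left_lt.
Unshelve. all: by end_near. Qed.

Lemma nbhs_ex s P : (\forall r \near s, P r) <->
  exists2 d : R, 0 < d & forall r, `|r - s| < d -> P r.
Proof.
split=> [/nbhs_ballP[d /= d0 dP]|[d d0 dP]].
  by exists d => // r rd; apply: dP; rewrite /ball/= distrC.
by apply/nbhs_ballP; exists d => //= r; rewrite /ball/= distrC => /dP.
Qed.

Lemma within_ex (A : set R) s P : (\forall r \near within A (nbhs s), P r) <->
  exists2 d : R, 0 < d & forall r, A r -> `|r - s| < d -> P r.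
Proof.
rewrite -[X in X <-> _]/(\forall r \near s, A r -> P r) nbhs_ex.
by split=> -[d d0 dP]; exists d => // r; [move=> Ar /dP|move=> /dP]; exact.
Qed.

End Neighborhoods.

(** Let [S] be the set of [v] such that [P] holds on all of [[a, v]]. The closure hypothesis puts
    [sup S] into [S], and the extension hypothesis contradicts [sup S < b]. *)
Lemma real_induction (R : realType) (a b : R) (P : R -> Prop) :
  a <= b -> P a ->
  (forall v, a <= v < b -> P v ->
    exists2 w, v < w <= b & forall s, v < s <= w -> P s) ->
  (forall v, a < v <= b -> (forall s, a <= s < v -> P s) -> P v) ->
  P b.
Proof.
move=> ab Pa Pext Pcl.
pose S := [set v | a <= v <= b /\ forall s, a <= s <= v -> P s].
have Sa : S a.
  split; first by rewrite lexx.
  by move=> s; rewrite -eq_le => /eqP <-.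
have ubS : has_ubound S by exists b => v [/andP[]].
have supS : has_sup S by split => //; exists a.
have asup : a <= sup S by exact: ub_le_sup.
have supb : sup S <= b by apply: ge_sup; [exists a | move=> v [/andP[]]].
have below s : a <= s < sup S -> P s.
  move=> /andP[as_ sm].
  have [|v [_ vP] sv] := @sup_adherent _ S (sup S - s) _ supS.
    by rewrite subr_gt0.
  by apply: vP; rewrite as_/= ltW//; move: sv; rewrite opprB addrC subrK.
have Psup : P (sup S).
  have [->//|asup'] := eqVneq (sup S) a.
  by apply: Pcl => //; rewrite supb andbT lt_neqAle eq_sym asup'.
have [<-//|supb'] := eqVneq (sup S) b.
have supltb : sup S < b by rewrite lt_neqAle supb'.
have [|w /andP[sw wb] wP] := Pext _ _ Psup; first by rewrite asup.
suff Sw : S w by have := ub_le_sup ubS Sw; rewrite leNgt sw.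
split; first by rewrite wb (le_trans asup (ltW sw)).
move=> s /andP[as_ sw']; have [ssup|] := ltP s (sup S).
  by apply: below; rewrite as_.
rewrite le_eqVlt => /orP[/eqP <-//|ssup].
by apply: wP; rewrite ssup.
Qed.

Section AbsolutelyContinuous.
Context {R : realType} {V : normedModType R}.
Implicit Types (N : V -> R) (A : set R) (F G : R -> V).

(* N need not be a norm: with N the identity of R^o the bounds on increments
   below become one-sided. *)
Definition abs_cont N A F : Prop :=
  forall e : R, 0 < e -> exists2 d : R, 0 < d &
    forall (m : nat) (a b : 'I_m -> R),
      (forall i, a i <= b i /\ `[a i, b i]%classic `<=` A) ->
      trivIset setT (fun i => `]a i, b i[%classic) ->
      \sum_i (b i - a i) < d ->
      \sum_i N (F (b i) - F (a i)) < e.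

(** A bound on the upper right Dini derivative at [s] of [N (F r - F s)] as a function of [r].
    Looking only to the right fits the schemes, which may have corners at mesh points. *)
Definition slope_le N F (s C : R) : Prop :=
  forall e : R, 0 < e -> exists2 d : R, 0 < d &
    forall r, s < r < s + d -> N (F r - F s) <= (C + e) * (r - s).

Lemma abs_cont_sub N A B F : B `<=` A -> abs_cont N A F -> abs_cont N B F.
Proof.
move=> BA acF e e0; have [d d0 dP] := acF e e0.
exists d => // m a b abB; apply: dP => i.
by have [ab iB] := abB i; split => // x /iB /BA.
Qed.

Lemma abs_cont_lip N A F (L : R) : 0 <= L ->
  (forall s s', s <= s' -> `[s, s']%classic `<=` A ->
    N (F s' - F s) <= L * (s' - s)) ->
  abs_cont N A F.
Proof.
move=> L0 FL e e0; exists (e / (L + 1)); first by rewrite divr_gt0// ltr_wpDl.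
move=> m a b abA _ sd; have L1 : 0 < L + 1 by rewrite ltr_wpDl.
apply: (@le_lt_trans _ _ ((L + 1) * \sum_i (b i - a i))); last first.
  by rewrite mulrC -ltr_pdivlMr.
rewrite mulr_sumr; apply: ler_sum => i _; have [ab iA] := abA i.
apply: le_trans (FL _ _ ab iA) _.
by rewrite ler_wpM2r ?subr_ge0// lerDl.
Qed.

Lemma abs_contD N A F G : (forall u v, N (u + v) <= N u + N v) ->
  abs_cont N A F -> abs_cont N A G -> abs_cont N A (F \+ G).
Proof.
move=> ND acF acG e e0.
have e20 : 0 < e / 2 by rewrite divr_gt0.
have [d1 d10 d1P] := acF _ e20; have [d2 d20 d2P] := acG _ e20.
exists (Num.min d1 d2); first by rewrite lt_min d10.
move=> m a b abA tri; rewrite lt_min => /andP[s1 s2].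
rewrite [ltRHS](splitr e).
apply: le_lt_trans (ltrD (d1P _ _ _ abA tri s1) (d2P _ _ _ abA tri s2)).
rewrite -big_split/=; apply: ler_sum => i _; apply: le_trans (ND _ _).
by rewrite opprD addrACA.
Qed.

Lemma abs_contN N A F : (forall u, N (- u) = N u) ->
  abs_cont N A F -> abs_cont N A (fun s => - F s).
Proof.
move=> NN acF e e0; have [d d0 dP] := acF e e0.
exists d => // m a b abA tri sd.
by under eq_bigr => i _ do rewrite -opprD NN; exact: dP.
Qed.

Lemma abs_cont_at N A F e : 0 < e -> abs_cont N A F ->
  exists2 d : R, 0 < d & forall s s', s <= s' ->
    `[s, s']%classic `<=` A -> s' - s < d -> N (F s' - F s) < e.
Proof.
move=> e0 acF; have [d d0 dP] := acF e e0.
exists d => // s s' ss' sA sd.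
have := dP 1 (fun=> s) (fun=> s'); rewrite !big_ord1; apply => //.
by apply/trivIsetP => i j _ _; rewrite !ord1 eqxx.
Qed.

End AbsolutelyContinuous.

(** Outer regularity, applied to a measurable null set that contains the exceptional points. *)
Lemma lebesgue_null_open_cover (R : realType) (P : R -> Prop) (e : R) : 0 < e ->
  {ae lebesgue_measure, forall s, P s} ->
  exists O : set R, [/\ open O, forall s, ~ O s -> P s
    & (lebesgue_measure O < e%:E)%E].
Proof.
move=> e0 [A [mA A0 nPA]].
have Afin : (lebesgue_measure A < +oo)%E by rewrite A0 ltry.
have [ O [oO AO mO]] := lebesgue_regularity_outer mA Afin e0.
exists O; split => // [s nOs|].
  by apply: contrapT => nPs; apply: nOs; apply/AO/nPA.
apply: le_lt_trans mO.
have mO' : measurable O by exact: measurable_realfun.open_measurable.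
rewrite -{1}(setDUK AO) measureU ?setDIK//; last exact: measurableD.
rewrite [leLHS](_ : _ = lebesgue_measure A + lebesgue_measure (O `\` A))%E //.
by rewrite A0 add0e.
Qed.

Section DisjointIntervals.
Context {R : realType}.
Implicit Types (a b : nat -> R) (m : nat).

(** Ordering the intervals from left to right, with shared endpoints and degenerate intervals
    allowed, makes it possible to append one more interval at the right end of a chain. *)
Definition increasing_itvs (m : nat) a b : Prop :=
  (forall i, (i < m)%N -> a i <= b i) /\
  (forall i j, (i < j < m)%N -> b i <= a j).

Lemma increasing_itvs_trivIset m a b : increasing_itvs m a b ->
  trivIset setT (fun i : 'I_m => `]a i, b i[%classic).
Proof.
move=> [ab_ ba]; apply/trivIsetP => i j _ _ ij.
wlog: i j ij / (i < j)%N => [wl|lij].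
  have [|ji|eij] := ltngtP i j; first exact: wl.
    by rewrite setIC; apply: wl; rewrite // eq_sym.
  by move: ij; rewrite -val_eqE/= eij eqxx.
rewrite -subset0 => x [] /=; rewrite !in_itv/= => /andP[_ xb] /andP[ax _].
have := ba i j; rewrite lij ltn_ord => /(_ isT).
by move=> /(lt_le_trans xb)/lt_trans/(_ ax); rewrite ltxx.
Qed.

Lemma increasing_itvs_measure m a b (O : set R) : measurable O ->
  increasing_itvs m a b ->
  (forall i, (i < m)%N -> `[a i, b i]%classic `<=` O) ->
  ((\sum_(i < m) (b i - a i))%:E <= lebesgue_measure O)%E.
Proof.
move=> mO mab abO.
pose F i := if (i < m)%N then `]a i, b i[%classic else set0 : set R.
have mF i : measurable (F i) by rewrite /F; case: ifP.
have triF : trivIset setT F.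
  apply/trivIsetP => i j _ _ ij; rewrite /F.
  case: ifPn => im; last by rewrite set0I.
  case: ifPn => jm; last by rewrite setI0.
  have /trivIsetP/(_ (Ordinal im) (Ordinal jm) I I) := increasing_itvs_trivIset
    mab.
  by apply; rewrite -val_eqE.
have -> : ((\sum_(i < m) (b i - a i))%:E =
    lebesgue_measure (\big[setU/set0]_(i < m) F i))%E.
  rewrite measure_bigsetU//= -sumEFin; apply: eq_bigr => i _.
  rewrite /F ltn_ord lebesgue_measure_itv/= lte_fin; case: ltP => // ba.
  have /eqP -> : a i == b i by rewrite eq_le ba andbT; case: mab => + _; apply.
  by rewrite subrr.
apply: le_measure; rewrite ?inE//; first by apply: bigsetU_measurable => i _;
  exact: mF.
rewrite -bigcup_mkord => x [i /= im]; rewrite /F im => /subset_itv_oo_cc.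
exact: abO.
Qed.

End DisjointIntervals.

Section Increments.
Context {R : realType} {V : normedModType R}.
Variable N : V -> R.
Hypothesis ND : forall u v, N (u + v) <= N u + N v.

(* A chain of sums of increments over intervals inside an open set O of small
   measure takes care of the exceptional points: the bound propagates to the
   right by the slope estimate off O, and by adding an interval to the chain
   in O. *)
Lemma abs_cont_increment_le (F : R -> V) (a b C : R) : a <= b -> 0 <= C ->
  abs_cont N `[a, b] F ->
  {ae lebesgue_measure, forall s, a <= s < b -> slope_le N F s C} ->
  N (F b - F a) <= C * (b - a).
Proof.
move=> ab C0 acF aeF; apply/ler_addgt0Pr => e1 e10.
have ba2 : 0 < b - a + 2 by rewrite ltr_wpDl// subr_ge0.
(* Three errors have to fit into [e1]: [e * (b - a)] from the slopes, [e] from the chain inside [O],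
   and [e] from the slack [y]. *)
pose e := e1 / (b - a + 2); have e0 : 0 < e by rewrite divr_gt0.
have [d d0 dP] := acF e e0.
have [ O [oO OP mO]] := lebesgue_null_open_cover d0 aeF.
have mO' : measurable O by exact: measurable_realfun.open_measurable.
pose chain (v : R) (m : nat) (c1 c2 : nat -> R) :=
  increasing_itvs m c1 c2 /\
  forall i, (i < m)%N -> [/\ `[c1 i, c2 i]%classic `<=` O, a <= c1 i & c2 i <=
    v].
(* The chain may depend on the slack [y]. In the closure step, half of the slack pays for the
   increment from a nearby [s < v] up to [v]. *)
pose P v := forall y : R, 0 < y -> exists m c1 c2, chain v m c1 c2 /\
  N (F v - F a) <= (C + e) * (v - a) + \sum_(i < m) N (F (c2 i) - F (c1 i)) + y.
have Ce0 : 0 <= C + e by rewrite addr_ge0// ltW.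
suff Pb : P b.
  have [m [c1 [c2 [[cc cO] Fb]]]] := Pb e e0.
  have : \sum_(i < m) N (F (c2 i) - F (c1 i)) < e.
    apply: (dP m (fun i => c1 i) (fun i => c2 i)).
    - move=> i; split; first by case: cc => + _; apply.
      move=> x; have [_ ac cb] := cO i (ltn_ord i).
      rewrite /= !in_itv/= => /andP[cx xc].
      by rewrite (le_trans ac cx) (le_trans xc cb).
    - exact: increasing_itvs_trivIset.
    - rewrite -lte_fin; apply: le_lt_trans mO.
      by apply: increasing_itvs_measure => // i /cO[].
  move=> se; apply: (le_trans Fb).
  have -> : e1 = e * (b - a + 2) by rewrite /e divfK// gt_eqF.
  by rewrite (_ : _ + e * _ = (C + e) * (b - a) + e + e); [|ring];
    rewrite lerD2r lerD2l ltW.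
(* Subadditivity gives only [0 <= N 0]; the other inequality comes from absolute continuity over a
   degenerate interval. *)
have N0le : N 0 <= 0.
  apply/ler_addgt0Pr => y y0.
  have [d' d'0 d'P] := abs_cont_at y0 acF.
  have := d'P a a (lexx _); rewrite !subrr add0r => /(_ _ d'0)/ltW; apply.
  by move=> x; rewrite /= !in_itv/= => /andP[ax xa]; rewrite ax (le_trans xa).
apply: (@real_induction _ a) => //.
- move=> y y0; exists 0%N, (fun=> a), (fun=> a); split.
    by split; [split => // i j; rewrite ltn0 andbF|].
  by rewrite big_ord0 !subrr mulr0 !add0r (le_trans N0le)// ltW.
- move=> v /andP[av vb] Pv.
  have [Ov|nOv] := pselect (O v).
    have [r /= r0 rO] : \forall r \near v, O r by exact: open_nbhs_nbhs.
    exists (Num.min b (v + r / 2)).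
      by rewrite lt_min vb ltrDl divr_gt0//= ge_min lexx.
    move=> s /andP[vs]; rewrite le_min => /andP[sb sr] y y0.
    have [m [c1 [c2 [[[cc1 cc2] cO] Fv]]]] := Pv y y0.
    exists m.+1, (fun i => if (i < m)%N then c1 i else v),
      (fun i => if (i < m)%N then c2 i else s); split.
      split; first split.
      - by move=> i _ /=; case: ltnP => [im|_]; [exact: cc1|exact: ltW].
      - move=> i j /andP[ij jm] /=; have im := leq_trans ij jm.
        rewrite (leq_trans ij) 1?ltnS; last by rewrite -ltnS.
        case: ltnP => jm'; first by apply: cc2; rewrite ij.
        by have [] := cO i; first exact: leq_trans ij _.
      - move=> i _ /=; case: ltnP => im.
          by have [? ? ?] := cO i im; split => //;
            rewrite (le_trans _ (ltW vs)).
        split => //; move=> x /=; rewrite in_itv/= => /andP[vx xs].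
        apply: rO; rewrite /ball_/= ler0_norm ?subr_le0// opprB ltrBlDl.
        apply: (le_lt_trans xs); apply: (le_lt_trans sr).
        by rewrite ltrD2l ltr_pdivrMr// ltr_pMr// ltr1n.
    rewrite big_ord_recr/= ltnn.
    under eq_bigr => i _ do rewrite ltn_ord.
    have -> : F s - F a = (F v - F a) + (F s - F v) by rewrite [RHS]addrC
      [RHS]addrA subrK.
    apply: (le_trans (ND _ _)).
    have : (C + e) * (v - a) <= (C + e) * (s - a).
      by rewrite ler_wpM2l// lerD2r ltW.
    by move: Fv; set X := \sum_(i < m) _; set Y := N (F v - _); lra.
  have := OP v nOv; rewrite av vb => /(_ isT e e0)[r r0 rP].
  exists (Num.min b (v + r / 2)).
    by rewrite lt_min vb ltrDl divr_gt0//= ge_min lexx.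
  move=> s /andP[vs]; rewrite le_min => /andP[sb sr] y y0.
  have [m [c1 [c2 [[cc cO] Fv]]]] := Pv y y0.
  exists m, c1, c2; split.
    split => // i im; have [? ? cv] := cO i im; split => //.
    exact: le_trans (ltW vs).
  have : N (F s - F v) <= (C + e) * (s - v).
    apply: rP; rewrite vs/= (le_lt_trans sr)// ltrD2l.
    by rewrite ltr_pdivrMr// ltr_pMr// ltr1n.
  have -> : F s - F a = (F v - F a) + (F s - F v) by rewrite [RHS]addrC
    [RHS]addrA subrK.
  have := ND (F v - F a) (F s - F v).
  have -> : (C + e) * (s - a) = (C + e) * (v - a) + (C + e) * (s - v) by ring.
  by move: Fv; set X := \sum_(i < m) _; lra.
- move=> v /andP[av vb] Pv y y0.
  have y20 : 0 < y / 2 by rewrite divr_gt0.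
  have [r r0 rP] := abs_cont_at y20 acF.
  pose s := Num.max a (v - r / 2).
  have sv : s < v by rewrite gt_max av/= ltrBlDr ltrDl divr_gt0.
  have as_ : a <= s by rewrite le_max lexx.
  have [|m [c1 [c2 [[cc cO] Fs]]]] := Pv s _ _ y20; first by rewrite as_.
  exists m, c1, c2; split.
    split => // i im; have [? ? cs] := cO i im; split => //.
    exact: le_trans (ltW sv).
  have : N (F v - F s) < y / 2.
    apply: rP; first exact: ltW.
      move=> x; rewrite /= !in_itv/= => /andP[sx xv].
      by rewrite (le_trans as_ sx) (le_trans xv vb).
    have : v - r / 2 <= s by rewrite le_max lexx orbT.
    have : r / 2 < r by rewrite ltr_pdivrMr// ltr_pMr// ltr1n.
    lra.
  have -> : F v - F a = (F s - F a) + (F v - F s) by rewrite [RHS]addrC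
    [RHS]addrA subrK.
  have := ND (F s - F a) (F v - F s).
  have : (C + e) * (s - a) <= (C + e) * (v - a) by rewrite ler_wpM2l// lerD2r
    ltW.
  have -> : y = y / 2 + y / 2 by field.
  by move: Fs; set X := \sum_(i < m) _; lra.
Qed.

End Increments.

(** * Norms and first-order expansions *)

Lemma lipschitz_at_continuous (R : realType) (V : normedModType R) (f : V -> R)
    (C : R) : 0 < C -> (forall u v, `|f u - f v| <= C * `|u - v|) ->
  continuous f.
Proof.
move=> C0 fC u; apply/cvgrPdist_le => e e0; near=> v.
apply: (le_trans (fC _ _)); rewrite mulrC -ler_pdivlMr//.
by near: v; apply: cvgr_dist_le; rewrite ?divr_gt0//; exact: cvg_id.
Unshelve. all: by end_near. Qed.

Section NormEquivalence.
Context {R : realType} {n : nat} {N : 'rV[R]_n -> R}.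
Hypothesis hN : is_norm N.

Lemma is_normD u v : N (u + v) <= N u + N v. Proof. by case: hN. Qed.

Lemma is_normZ a u : N (a *: u) = `|a| * N u. Proof. by case: hN. Qed.

Lemma is_norm0 : N 0 = 0.
Proof. by rewrite -(scale0r 0) is_normZ normr0 mul0r. Qed.

Lemma is_normN u : N (- u) = N u.
Proof. by rewrite -scaleN1r is_normZ normrN1 mul1r. Qed.

Lemma is_norm_ge0 u : 0 <= N u.
Proof.
by have := is_normD u (- u);
  rewrite subrr is_norm0 is_normN -mulr2n pmulrn_lge0.
Qed.

Lemma is_norm_distC u v : N (u - v) = N (v - u).
Proof. by rewrite -is_normN opprB. Qed.

Lemma is_norm_distD w u v : N (u - v) <= N (u - w) + N (w - v).
Proof. by apply: le_trans (is_normD _ _); rewrite addrA subrK. Qed.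

Lemma is_normB u v : N (u - v) <= N u + N v.
Proof. by apply: le_trans (is_normD _ _) _; rewrite is_normN. Qed.

Lemma is_norm_le_dist u v : N u <= N v + N (u - v).
Proof. by apply: le_trans (is_normD _ _); rewrite addrC subrK. Qed.

Lemma is_norm_le_mx_norm : exists2 C : R, 0 < C & forall u, N u <= C * `|u|.
Proof.
(* The summand 1 keeps the constant positive even when [n = 0]. *)
exists (1 + \sum_j N (delta_mx 0 j)).
  by rewrite ltr_pwDl// sumr_ge0// => j _; exact: is_norm_ge0.
move=> u; rewrite mulrDl mul1r; apply: ler_wpDl => //.
rewrite {1}(row_sum_delta u) mulr_suml.
elim/big_ind2 : _ => [|a b v w av bw|j _]; first by rewrite is_norm0.
  by apply: le_trans (is_normD _ _) _; exact: lerD.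
rewrite is_normZ mulrC ler_wpM2l ?is_norm_ge0//.
rewrite [leRHS]/Num.norm/= mx_normrE; apply/bigmax_geP; right.
by exists (0, j).
Qed.

Lemma is_norm_continuous : continuous N.
Proof.
have [C C0 NC] := is_norm_le_mx_norm.
apply: (@lipschitz_at_continuous _ _ N C C0) => u v.
apply: le_trans (NC _); rewrite ler_norml lerBlDr lerBrDr addrC lerBlDr.
have := is_norm_le_dist u v; have := is_norm_le_dist v u.
by rewrite (is_norm_distC v u) addrC => ->; rewrite addrC => ->.
Qed.

(** The continuous function [N] attains a positive minimum on the compact unit sphere of the matrix
    norm, and its inverse is the constant. The sphere is empty when [n = 0], where every vector is
    0. *)
Lemma mx_norm_le_is_norm : exists2 C : R, 0 < C & forall u, `|u| <= C * N u.
Proof.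
pose S : set 'rV[R]_n := [set u | `|u| = 1].
have cS : compact S.
  apply: bounded_closed_compact.
    by exists 1; split => // x x1 u /= ->; exact: ltW.
  have -> : S = (fun u : 'rV[R]_n => `|u|) @^-1` [set 1] by [].
  apply: preimage_closed; first by move=> u _; exact: norm_continuous.
  exact: closed_eq.
have [[v Sv]|S0] := pselect (S !=set0); last first.
  exists 1 => // u; have [->|u0] := eqVneq u 0.
    by rewrite normr0 mul1r is_norm_ge0.
  exfalso; apply: S0; exists (`|u|^-1 *: u).
  by rewrite /S/= normrZ normfV normr_id mulVf// normr_eq0.
have [||w /set_mem Sw wmin] := compact_EVT_min _ cS (f := N).
- by exists v.
- exact/continuous_subspaceT/is_norm_continuous.
have Nw : 0 < N w.
  rewrite lt_neqAle is_norm_ge0 andbT eq_sym; apply/eqP => Nw0.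
  have w0 : w = 0 by case: hN => _ _; apply.
  by move: Sw; rewrite /S/= w0 normr0 => /esym/eqP; rewrite oner_eq0.
exists (N w)^-1; first by rewrite invr_gt0.
move=> u; have [->|u0] := eqVneq u 0.
  by rewrite normr0 mulr_ge0// ?invr_ge0 is_norm_ge0.
have un : 0 < `|u| by rewrite normr_gt0.
have := wmin (`|u|^-1 *: u); rewrite is_normZ normfV normr_id => wmin'.
rewrite mulrC ler_pdivlMr// mulrC -ler_pdivlMr// mulrC; apply/wmin'/mem_set.
by rewrite /S/= normrZ normfV normr_id mulVf// gt_eqF.
Qed.

End NormEquivalence.

Lemma subrACA (V : zmodType) (x y z w : V) :
  x - y - (z - w) = x - z - (y - w).
Proof. by rewrite !opprD !opprK addrACA. Qed.

Section FirstOrder.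
Context {R : realType} {V : normedModType R}.
Implicit Types (F G : R -> V) (A B : set R) (s : R) (D : V).

(** Differentiability in little-o form. Choosing [A] covers right derivatives, derivatives relative
    to [[0, alpha]] and two-sided ones, and [r = s] needs no exclusion. *)
Definition expansion_within A F s (D : V) : Prop :=
  forall e : R, 0 < e -> exists2 d : R, 0 < d & forall r, A r -> `|r - s| < d ->
    `|F r - F s - (r - s) *: D| <= e * `|r - s|.

Lemma derivative_withinP A F s D :
  derivative_within A F s D <-> expansion_within A F s D.
Proof.
have E r : r != s ->
    `|D - (r - s)^-1 *: (F r - F s)| * `|r - s| = `|F r - F s - (r - s) *: D|.
  move=> rs; rewrite -subr_eq0 in rs.
  rewrite mulrC -normrZ scalerBr scalerA mulfV// scale1r -normrN.
  by rewrite opprB.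
split=> [/cvgrPdist_le h e e0|h].
  have /within_ex[d d0 dP] := h e e0.
  exists d => // r Ar rd; have [->|rs] := eqVneq r s.
    by rewrite !subrr scale0r subr0 !normr0 mulr0.
  rewrite -E// ler_wpM2r//; apply: dP => //; split => //.
  by move=> /= ers; move: rs; rewrite ers eqxx.
apply/cvgrPdist_le => e e0; apply/within_ex.
have [d d0 dP] := h e e0; exists d => // r [Ar /eqP rs] rd.
rewrite -(@ler_pM2r _ `|r - s|) ?normr_gt0 ?subr_eq0// E//.
exact: dP.
Qed.

Lemma right_derivativeP F s D :
  (r - s)^-1 *: (F r - F s) @[r --> s^'+] --> D <->
  expansion_within [set r | s < r] F s D.
Proof.
rewrite -derivative_withinP /derivative_within.
suff -> : [set r | s < r] `\ s = [set r | s < r] by [].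
apply/seteqP; split => r /=; first by case.
by move=> sr; split => // rs; move: sr; rewrite rs ltxx.
Qed.

Lemma is_deriveP F s D : is_derive s 1 F D <-> expansion_within setT F s D.
Proof.
have E (h : R) : F (h *: 1 + s) = F (h + s) by rewrite [_ *: _]mulr1.
rewrite -derivative_withinP; split.
  move=> [dF DF]; apply/cvgrPdist_le => e e0; apply/within_ex.
  have : h^-1 *: ((F \o shift s) (h *: 1) - F s) @[h --> 0^'] --> D.
    by rewrite -DF; exact: dF.
  move=> /cvgrPdist_le/(_ e e0)/within_ex[d d0 dP].
  exists d => // r [_ /eqP/= rs] rd; have := dP (r - s).
  by rewrite subr_eq0 subr0/= E subrK => /(_ rs rd).
move=> h; have cF : h^-1 *: ((F \o shift s) (h *: 1) - F s) @[h --> 0^'] --> D.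
  apply/cvgrPdist_le => e e0; apply/within_ex.
  move/cvgrPdist_le: h => /(_ e e0)/within_ex[d d0 dP].
  exists d => // r /= r0; rewrite subr0 => rd; have := dP (r + s).
  rewrite addrK E; apply => //; split => //= /eqP.
  by rewrite -subr_eq0 addrK; exact/negP.
split; last exact: cvg_lim.
by apply/cvg_ex; exists D.
Qed.

Lemma expansion_within_sub A B F s D : A `<=` B ->
  expansion_within B F s D -> expansion_within A F s D.
Proof.
move=> AB h e e0; have [d d0 dP] := h e e0.
by exists d => // r /AB Br; exact: dP.
Qed.

Lemma expansion_withinB A F G s D E : expansion_within A F s D ->
  expansion_within A G s E -> expansion_within A (fun r => F r - G r) s (D - E).
Proof.
move=> hF hG e e0; have e20 : 0 < e / 2 by rewrite divr_gt0.
have [d1 d10 d1P] := hF _ e20; have [d2 d20 d2P] := hG _ e20.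
exists (Num.min d1 d2); first by rewrite lt_min d10.
move=> r Ar; rewrite lt_min => /andP[r1 r2].
have -> : F r - G r - (F s - G s) - (r - s) *: (D - E) =
    (F r - F s - (r - s) *: D) - (G r - G s - (r - s) *: E).
  by rewrite scalerBr (subrACA (F r)); exact: subrACA.
apply: (le_trans (ler_normB _ _)).
have := d1P _ Ar r1; have := d2P _ Ar r2.
rewrite [in leRHS](splitr e) mulrDl; lra.
Qed.

Lemma expansion_within_linear A (D : V) s :
  expansion_within A (fun r => r *: D) s D.
Proof.
by move=> e e0; exists 1 => // r _ _;
  rewrite -scalerBl subrr normr0 mulr_ge0// ltW.
Qed.

(** Only positive homogeneity is asked of [N], so that the identity of [R^o] qualifies and yields
    one-sided slope bounds. *)
Lemma expansion_slope_le (N : V -> R) C0 C F s D :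
  (forall u v, N (u + v) <= N u + N v) ->
  (forall a u, 0 <= a -> N (a *: u) = a * N u) -> 0 < C0 ->
  (forall u, N u <= C0 * `|u|) -> N D <= C ->
  expansion_within [set r | s < r] F s D -> slope_le N F s C.
Proof.
move=> ND NZ C00 NC DC h e e0; have [|d d0 dP] := h (e / C0).
  by rewrite divr_gt0.
exists d => // r /andP[sr rd]; have rs : 0 <= r - s by rewrite subr_ge0 ltW.
have := dP _ sr; rewrite ger0_norm// ltrBlDl => /(_ rd).
rewrite -(ler_pM2l C00) => /(le_trans (NC _)).
have -> : C0 * (e / C0 * (r - s)) = e * (r - s).
  by field; rewrite gt_eqF.
move=> h1; rewrite -[F r - F s](subrK ((r - s) *: D)) mulrDl [leRHS]addrC.
apply: (le_trans (ND _ _)); apply: (lerD h1).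
by rewrite NZ// mulrC ler_wpM2r.
Qed.

End FirstOrder.

(** Compactness provides a cluster point, and an ultrafilter converges to each of its cluster
    points: otherwise it would contain the complement of a neighbourhood. *)
Lemma ultra_compact_cvg (I : Type) (V : ptopologicalType) (U : set_system I)
    (F : I -> V) (A : set V) : UltraFilter U -> compact A -> (F @ U) A ->
  cvg (F @ U).
Proof.
move=> UU cA FA; have [p [_ clp]] := cA (F @ U) _ FA.
apply/cvg_ex; exists p => P Pp.
have [//|nP] := in_ultra_setVsetC (F @^-1` P) UU.
by have [q []] := clp (~` P) P nP Pp.
Qed.

Lemma compact_closed_ball0 (R : realType) (m : nat) (B : R) :
  compact [set u : 'rV[R]_m | `|u| <= B].
Proof.
apply: bounded_closed_compact.
  exists B; split; [exact: num_real|move=> x Bx u /= /le_trans ->//;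
    exact: ltW].
have -> : [set u : 'rV[R]_m | `|u| <= B] =
  (fun u : 'rV[R]_m => `|u|) @^-1` [set y | y <= B] by [].
apply: preimage_closed; first by move=> u _; exact: norm_continuous.
exact: closed_le.
Qed.

(** * Null sets, continuity of the data and knots *)

Lemma ae_imply2 (R : realType) (P Q S : R -> Prop) :
  (forall s, P s -> Q s -> S s) ->
  {ae lebesgue_measure, forall s, P s} -> {ae lebesgue_measure, forall s, Q s} ->
  {ae lebesgue_measure, forall s, S s}.
Proof.
move=> PQS hP hQ; apply: negligibleS (negligibleU hP hQ) => s /= nS.
by apply: contrapT => /not_orP[/contrapT Ps /contrapT Qs]; exact/nS/PQS.
Qed.

Lemma ae_imply (R : realType) (P S : R -> Prop) : (forall s, P s -> S s) ->
  {ae lebesgue_measure, forall s, P s} -> {ae lebesgue_measure, forall s, S s}.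
Proof. by move=> PS hP; apply: (ae_imply2 _ hP hP) => s _ /PS. Qed.

Lemma ae_exists_itv (R : realType) (P : R -> Prop) (a b : R) : a < b ->
  {ae lebesgue_measure, forall s, P s} -> exists2 r, a < r < b & P r.
Proof.
move=> ab aeP; apply: contrapT => nP.
have ba0 : 0 < b - a by rewrite subr_gt0.
have [ O [oO OP]] := lebesgue_null_open_cover ba0 aeP.
apply/negP; rewrite -leNgt.
have -> : ((b - a)%:E = lebesgue_measure `]a, b[%classic :> \bar R)%E.
  by rewrite lebesgue_measure_itv/= lte_fin ab.
apply: le_measure; rewrite ?inE//.
  exact: measurable_realfun.open_measurable.
move=> r; rewrite /= in_itv/= => arb; apply: contrapT => nO.
by apply: nP; exists r => //; exact: OP.
Qed.

Lemma le0_halving (R : realType) (x B : R) : 0 <= B ->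
  (forall m : nat, x <= B / 2 ^+ m) -> x <= 0.
Proof.
move=> B0 xB; rewrite leNgt; apply/negP => x0.
have [m xm] : exists m : nat, B / x < m%:R.
  by exists (Num.bound (B / x)); rewrite archi_boundP// divr_ge0// ltW.
have := xB m; rewrite leNgt => /negP; apply.
rewrite ltr_pdivrMr ?exprn_gt0// mulrC -ltr_pdivrMr//.
apply: (lt_trans xm); rewrite -natrX ltr_nat; exact: ltn_expl.
Qed.

Section Continuity.
Context {R : realType} {n : nat} {N : 'rV[R]_n -> R}.
Hypothesis hN : is_norm N.

Lemma within_cont_ex (V : normedModType R) (A : set R) (F : R -> V) s :
  {within A, continuous F} -> A s -> forall e : R, 0 < e ->
  exists2 d : R, 0 < d &
    forall r, A r -> `|r - s| < d -> `|F r - F s| < e.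
Proof.
move=> /subspace_continuousP/(_ s) cF As e e0.
have /cvgrPdist_lt/(_ e e0)/within_ex[d d0 dP] := cF As.
by exists d => // r Ar rd; rewrite distrC dP.
Qed.

Lemma hyp_g_cont T (g : R -> 'rV[R]_n -> R -> R) s0 u0 w0 : hyp_g N T g ->
  0 <= s0 <= T -> forall e : R, 0 < e -> exists2 d : R, 0 < d &
    forall s u w, 0 <= s <= T -> `|s - s0| < d -> N (u - u0) < d ->
      `|w - w0| < d -> `|g s u w - g s0 u0 w0| < e.
Proof.
move=> [cg _ _] s0T e e0.
have [c c0 cN] := mx_norm_le_is_norm hN.
move/subspace_continuousP : cg => /(_ (s0, u0, w0) s0T) /cvgrPdist_lt/(_ e e0).
rewrite near_withinE => /nbhs_ballP[d /= d0 dP].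
(* Since [c] turns [N]-balls into balls of the matrix norm, dividing by [1 + c] brings both the
   radius and [c] times the radius below [d]. *)
have dc : 0 < d / (1 + c) by rewrite divr_gt0// addr_gt0.
have dcd : d / (1 + c) <= d.
  by rewrite ler_pdivrMr ?addr_gt0// ler_peMr ?(ltW d0)// lerDl ltW.
exists (d / (1 + c)) => // s u w sT sd ud wd; rewrite distrC.
apply: (dP (s, u, w)) => //; split; first split => /=.
- by rewrite /ball/= distrC (lt_le_trans sd).
- rewrite -ball_normE/= distrC (le_lt_trans (cN _))//.
  apply: (@lt_le_trans _ _ (c * (d / (1 + c)))); first by rewrite ltr_pM2l.
  rewrite mulrCA ler_piMr ?(ltW d0)// ler_pdivrMr ?addr_gt0// mul1r.
  by rewrite lerDr.
- by rewrite /ball/= distrC (lt_le_trans wd).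
Qed.

Lemma hyp_f_cont T (f : R -> 'rV[R]_n -> 'rV[R]_n -> 'rV[R]_n) s0 u0 v0 :
  hyp_f N T f ->
  0 <= s0 <= T -> forall e : R, 0 < e -> exists2 d : R, 0 < d &
    forall s u v, 0 <= s <= T -> `|s - s0| < d -> N (u - u0) < d ->
      N (v - v0) < d -> N (f s u v - f s0 u0 v0) < e.
Proof.
move=> [cf _] s0T e e0.
have [c c0 cN] := mx_norm_le_is_norm hN.
have [C C0 NC] := is_norm_le_mx_norm hN.
have eC : 0 < e / C by rewrite divr_gt0.
move/subspace_continuousP : cf => /(_ (s0, u0, v0) s0T) /cvgrPdist_lt/(_ _ eC).
rewrite near_withinE => /nbhs_ballP[d /= d0 dP].
have dc : 0 < d / (1 + c) by rewrite divr_gt0// addr_gt0.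
have dcd : d / (1 + c) <= d.
  by rewrite ler_pdivrMr ?addr_gt0// ler_peMr ?(ltW d0)// lerDl ltW.
have dcc : c * (d / (1 + c)) <= d.
  rewrite mulrCA ler_piMr ?(ltW d0)// ler_pdivrMr ?addr_gt0// mul1r.
  by rewrite lerDr.
exists (d / (1 + c)) => // s u v sT sd ud vd.
apply: (le_lt_trans (NC _)); rewrite mulrC -ltr_pdivlMr// distrC.
apply: (dP (s, u, v)) => //; split; first split => /=.
- by rewrite /ball/= distrC (lt_le_trans sd).
- rewrite -ball_normE/= distrC (le_lt_trans (cN _))//.
  by apply: lt_le_trans dcc; rewrite ltr_pM2l.
- rewrite -ball_normE/= distrC (le_lt_trans (cN _))//.
  by apply: lt_le_trans dcc; rewrite ltr_pM2l.
Qed.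

End Continuity.

Section Knots.
Context {R : realType} {T : R} {K : nat} {t : int -> R}.
Hypothesis ht : knot_sequence T K t.


Lemma knot_lt (i j : int) : i < j -> j <= K%:Z + 1 -> t i < t j.
Proof.
case: ht => _ _ tS _ ij jK.
have [m jE] : exists m : nat, j = i + m.+1%:Z by exists `|(j - i - 1)%R|%N; lia.
rewrite {}jE {j ij} in jK *; elim: m jK => [|m IH] jK; first by apply: tS; lia.
apply: (lt_trans (IH _)); first lia.
have -> : i + m.+2%:Z = (i + m.+1%:Z) + 1 by lia.
by apply: tS; lia.
Qed.

Lemma knot_le (i j : int) : i <= j -> j <= K%:Z + 1 -> t i <= t j.
Proof.
rewrite le_eqVlt => /orP[/eqP -> //|ij jK]; exact/ltW/knot_lt.
Qed.

Lemma knot_below (s : R) : exists m : nat, t (- m%:Z) <= s.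
Proof.
case: ht => _ _ _ /cvgrNyPle/(_ s)[m _ mP].
by exists m; apply: mP => /=.
Qed.

(** Some knot [t (- m)] lies at or below [s]; after a shift by [m] the search is a bounded maximum
    over natural numbers. The index [K + 1] is left out because the last interval is closed at
    [T]. *)
Lemma knot_last (s : R) : exists2 k : int, k <= K%:Z &
  t k <= s /\ forall j : int, j <= K%:Z -> t j <= s -> j <= k.
Proof.
have [m ms] := knot_below s.
pose P (j : nat) := t (j%:Z - m%:Z) <= s.
pose Q (j : nat) := (j <= m + K)%N && P j.
have exQ : exists j, Q j by exists 0%N; rewrite /Q/P/= sub0r.
have Qub j : Q j -> (j <= m + K)%N by case/andP.
case: (ex_maxnP exQ Qub) => j /andP[jm Pj] jmax.
exists (j%:Z - m%:Z); first lia.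
split => // i iK tis; have [im|mi] := lerP i (- m%:Z); first lia.
have iE : (absz (i + m%:Z))%:Z = i + m%:Z by lia.
have : (absz (i + m%:Z)%R <= j)%N; last lia.
by apply: jmax; rewrite /Q /P iE addrK tis andbT; lia.
Qed.

Lemma impulse_itvE k s : k <= K%:Z ->
  impulse_itv T K t k s <-> [/\ t k <= s, s <= T & (k < K%:Z -> s < t (k + 1))].
Proof.
move=> kK; rewrite /impulse_itv; case: ifPn => [k_lt|].
  rewrite /= in_itv/=; split=> [/andP[-> sk]|[-> _ ->//]].
  split => //; case: ht => _ <- _ _; apply: (le_trans (ltW sk)).
  by apply: knot_le; lia.
rewrite -leNgt => Kk; have -> : k = K%:Z by lia.
rewrite /= in_itv/=; split=> [/andP[-> ->]|[-> -> //]].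
by split => //; lia.
Qed.

Lemma impulse_itv_cover s : s <= T ->
  exists2 k : int, k <= K%:Z & impulse_itv T K t k s /\ (0 <= s -> 0 <= k).
Proof.
move=> sT; have [k kK [tk kmax]] := knot_last s; exists k => //; split.
  apply/impulse_itvE => //; split => // k_lt; rewrite ltNge; apply/negP => ks.
  by have := kmax _ _ ks; lia.
by move=> s0; apply: kmax => //; case: ht => ->.
Qed.

Lemma impulse_itv_convex k a b s : k <= K%:Z -> impulse_itv T K t k a ->
  impulse_itv T K t k b -> a <= s <= b -> impulse_itv T K t k s.
Proof.
move=> kK /impulse_itvE -/(_ kK)[ka _ _] /impulse_itvE -/(_ kK)[_ bT kb].
move=> /andP[as_ sb]; apply/impulse_itvE => //; split.
- exact: le_trans as_.
- exact: le_trans bT.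
- by move=> /kb; exact: le_lt_trans.
Qed.

(** Unlike on the left, no exception is made for the knot [s = t k]: this asymmetry is what a rising
    delayed argument can exploit. *)
Lemma impulse_itv_right k s : k <= K%:Z -> impulse_itv T K t k s -> s < T ->
  exists2 e : R, 0 < e & forall r, s <= r < s + e -> impulse_itv T K t k r.
Proof.
move=> kK /impulse_itvE -/(_ kK)[ks _ sk] sT.
exists (if k < K%:Z then t (k + 1) - s else T - s).
  by case: ifPn => [/sk|_]; rewrite subr_gt0.
have tT : k < K%:Z -> t (k + 1) <= T.
  by case: ht => _ <- _ _ k_lt; apply: knot_le; lia.
move=> r /andP[sr]; case: ifPn => [k_lt|k_ge]; rewrite addrC subrK => rk;
  apply/impulse_itvE => //; split => //.
- exact: le_trans sr.
- exact: le_trans (ltW rk) (tT k_lt).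
- exact: le_trans sr.
- exact: ltW.
- by move=> k_lt; rewrite k_lt in k_ge.
Qed.

Lemma impulse_itv_left k s : k <= K%:Z -> impulse_itv T K t k s -> s != t k ->
  exists2 e : R, 0 < e & forall r, s - e < r <= s -> impulse_itv T K t k r.
Proof.
move=> kK /impulse_itvE -/(_ kK)[ks sT sk] sk'.
exists (s - t k); first by rewrite subr_gt0 lt_neqAle eq_sym sk'.
move=> r; rewrite opprB addrC subrK => /andP[kr rs].
apply/impulse_itvE => //; split; first exact: ltW.
  exact: le_trans sT.
by move=> /sk; exact: le_lt_trans.
Qed.

Lemma impulse_itv_near k s : k <= K%:Z -> impulse_itv T K t k s -> s != t k ->
  exists2 e : R, 0 < e & forall r, r <= T -> `|r - s| < e -> impulse_itv T K t
    k r.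
Proof.
move=> kK ks sk; have [e e0 eP] := impulse_itv_left kK ks sk.
move/impulse_itvE : (ks) => /(_ kK)[tks sT _].
have [sE|sT'] := eqVneq s T.
  exists e => // r rT; have rs : r <= s by rewrite sE.
  rewrite ler0_norm ?subr_le0// opprB => re.
  by apply: eP => //; rewrite rs andbT ltrBlDr -ltrBlDl.
have [|e' e'0 e'P] := impulse_itv_right kK ks; first by rewrite lt_neqAle sT'.
exists (Num.min e e'); first by rewrite lt_min e0.
move=> r _; rewrite lt_min !ltr_norml => /andP[/andP[re _] /andP[_ re']].
have [sr|/ltW rs] := leP s r; [apply: e'P|apply: eP]; rewrite ?sr ?rs ?andbT/=.
  by rewrite -ltrBlDl.
by rewrite -ltrBrDl.
Qed.

Lemma impulse_itv_not_impulse k s : k <= K%:Z -> impulse_itv T K t k s ->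
  t k < s -> ~ impulse_times K t s.
Proof.
move=> kK /impulse_itvE -/(_ kK)[_ _ sk] ks [j /andP[_ jK] sE].
rewrite sE in ks sk.
have kj : k < j%:Z.
  rewrite ltNge; apply/negP => jk; move: ks; rewrite ltNge => /negP; apply.
  by apply: knot_le => //; lia.
have := sk (lt_le_trans kj _); rewrite lez_nat => /(_ jK).
by rewrite ltNge knot_le//; lia.
Qed.

Lemma impulse_itv_before (k : int) : k < K%:Z -> forall r, t k <= r < t (k + 1) ->
  impulse_itv T K t k r.
Proof.
move=> kK r /andP[kr rk]; rewrite /impulse_itv kK /= in_itv/=.
by rewrite kr rk.
Qed.

End Knots.

(** * Uniqueness *)

Section Solutions.
Context {R : realType} {n : nat} {N : 'rV[R]_n -> R} {T : R} {K : nat}.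
Context {t : int -> R} {f : R -> 'rV[R]_n -> 'rV[R]_n -> 'rV[R]_n}.
Context {g : R -> 'rV[R]_n -> R -> R} {I : nat -> 'rV[R]_n -> 'rV[R]_n}.
Context {phi : R -> 'rV[R]_n} {lambda alpha : R}.
Hypothesis hN : is_norm N.
Hypothesis ht : knot_sequence T K t.
Hypothesis hf : hyp_f N T f.
Hypothesis hg : hyp_g N T g.
Hypothesis alphaT : 0 < alpha <= T.

Let sol := solution N T K t f g I phi lambda alpha.

Ltac clear_local := clear - hN ht hf hg alphaT sol.

Lemma solution_x_at y sigma k v : sol y sigma -> (k <= K)%N ->
  (impulse_itv T K t k%:Z `&` `[0, alpha]) v ->
  forall e : R, 0 < e -> exists2 d : R, 0 < d &
  forall s, (impulse_itv T K t k%:Z `&` `[0, alpha]) s -> `|s - v| < d ->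
    N (y s - y v) < e.
Proof.
move=> ys kK [kv v0a] e e0; have acy : abs_cont N _ y := sol_ac ys kK.
have [d d0 dP] := abs_cont_at e0 acy; exists d => // s [ks s0a] sd.
have kKz : k%:Z <= K%:Z by [].
have sub a b : (impulse_itv T K t k%:Z `&` `[0, alpha]) a ->
    (impulse_itv T K t k%:Z `&` `[0, alpha]) b ->
    `[a, b]%classic `<=` impulse_itv T K t k%:Z `&` `[0, alpha].
  move=> [ka a0] [kb b0] r; rewrite /= in_itv/= => arb; split.
    exact: (impulse_itv_convex ht kKz ka kb).
  move: a0 b0 arb; rewrite /= !in_itv/= => /andP[a0 _] /andP[_ ba] /andP[ar rb].
  by rewrite (le_trans a0 ar) (le_trans rb ba).
have [vs|/ltW sv] := leP v s.
  by apply: dP => //; [exact: sub|rewrite -[ltLHS]ger0_norm// subr_ge0].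
rewrite (is_norm_distC hN); apply: dP => //; first exact: sub.
by rewrite -[ltLHS]ger0_norm ?subr_ge0// distrC.
Qed.

(** The equation for [sigma] holds only almost everywhere, but [sigma] has a continuous derivative
    off the impulse times. The bound on [g] thus holds for that derivative at points arbitrarily
    close to any given one, passes to it by continuity, and the mean value theorem applies. *)
Lemma solution_tau_lipschitz y sigma (a b B : R) : sol y sigma ->
  0 <= a -> b <= alpha -> (forall r, a < r < b -> ~ impulse_times K t r) ->
  (forall r, a < r < b -> `|g r (y r) (sigma r)| <= B) ->
  forall s s', a <= s -> s <= s' -> s' <= b ->
    `|sigma s' - sigma s| <= B * (s' - s).
Proof.
move=> ys a0 ba noimp gB s s' as_ ss' s'b.
have [dg dgP cdg] := sol_tau_C1 ys.
have inD r : a < r < b -> (`[0, alpha] `\` impulse_times K t) r.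
  move=> arb; split; last exact: noimp.
  case/andP: arb => ar rb; rewrite /= in_itv/= (le_trans a0 (ltW ar))/=.
  exact: le_trans (ltW rb) ba.
have isd r : a < r < b -> is_derive r 1 sigma (dg r).
  move=> arb; apply/is_deriveP => e e0.
  have /derivative_withinP/(_ e e0)[d d0 dP] := dgP r (inD r arb).
  case/andP: (arb) => ar rb.
  exists (Num.min d (Num.min (r - a) (b - r))).
    by rewrite !lt_min d0 !subr_gt0 ar.
  move=> q _; rewrite !lt_min => /and3P[qd qa qb]; apply: dP => //.
  move: qa qb a0 ba; clear_local; rewrite !ltr_norml /= in_itv/=.
  by move=> /andP[? ?] /andP[? ?] ? ?; apply/andP; split; lra.
have dgB r : a < r < b -> `|dg r| <= B.
  move=> arb; rewrite leNgt; apply/negP => Bdg.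
  have e0 : 0 < `|dg r| - B by rewrite subr_gt0.
  have [d d0 dP] := within_cont_ex cdg (inD r arb) e0.
  case/andP: (arb) => ar rb.
  have [|q /andP[rq qd] qP] := @ae_exists_itv R _ r (Num.min b (r + d)) _
    (sol_tau_eq ys); first by rewrite lt_min rb ltrDl.
  move: qd; rewrite lt_min => /andP[qb qd].
  have arq : a < q < b by rewrite (lt_trans ar rq).
  have [q0a _] := inD q arq.
  have dq : dg q = g q (y q) (sigma q).
    have [_ <-] := isd q arq; have [|_ <-//] := qP _.
    by move: q0a; rewrite /= in_itv.
  have := dP q (inD q arq); rewrite gtr0_norm ?subr_gt0// ltrBlDl => /(_ qd).
  have := gB q arq; rewrite -dq => h1.
  have := ler_normD (dg q) (dg r - dg q); rewrite addrC subrK distrC.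
  by move: h1; clear_local; lra.
have cs : {within `[s, s'], continuous sigma}.
  apply: continuous_subspaceW (sol_tau_cont ys) => r; rewrite /= !in_itv/=.
  by move=> /andP[sr rs'];
    rewrite (le_trans a0)//= ?(le_trans as_)// (le_trans rs')// (le_trans s'b).
have isd' r : r \in `]s, s'[%R -> is_derive r 1 sigma (dg r).
  rewrite in_itv/= => /andP[sr rs']; apply: isd.
  by rewrite (le_lt_trans as_ sr) (lt_le_trans rs' s'b).
have [<-|ss''] := eqVneq s s'; first by rewrite !subrr normr0 mulr0.
have [|c] := MVT _ isd' cs; first by rewrite lt_neqAle ss''.
rewrite in_itv/= => /andP[sc cs'] ->.
rewrite normrM [X in _ * X]ger0_norm ?subr_ge0// ler_wpM2r ?subr_ge0//.
by apply: dgB; rewrite (le_lt_trans as_ sc) (lt_le_trans cs' s'b).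
Qed.

(** The quantitative hypotheses concern the time [v] alone, so that the lemma also serves for a
    competing solution, about which no bound is known after [v]. *)
Lemma solution_local y sigma v eta M : sol y sigma -> 0 <= v < alpha ->
  N (y v) <= M -> 0 < sigma v <= M -> g v (y v) (sigma v) < 1 -> 0 < eta ->
  exists (d B : R) (k : nat), [/\ 0 < d, v + d <= alpha, 0 <= B, (k <= K)%N
    & [/\ forall s, v <= s <= v + d -> [/\ impulse_itv T K t k%:Z s,
          N (y s) <= M + 1 & `|sigma s| <= M + 1],
        forall s, v <= s <= v + d ->
          v - sigma v <= s - sigma s < Num.min v (v - sigma v + eta)
      & forall s s', v <= s -> s <= s' -> s' <= v + d ->
          `|sigma s' - sigma s| <= B * (s' - s)]].
Proof.
move=> ys /andP[v0 va] yM /andP[sv0 svM] g1 eta0.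
have [alpha0 aT] := andP alphaT.
have vT : v < T by exact: lt_le_trans aT.
have [k' kK [kv /(_ v0) k0]] := impulse_itv_cover ht (ltW vT).
case: k' kK kv k0 => // k kK kv _.
have kK' : (k <= K)%N by exact: kK.
have [d1 d10 d1P] := impulse_itv_right ht kK kv vT.
have v0a : `[0, alpha]%classic v by rewrite /= in_itv/= v0 ltW.
have e0 : 0 < 1 - g v (y v) (sigma v) by rewrite subr_gt0.
have v0T : 0 <= v <= T by rewrite v0 ltW.
have [d2 d20 d2P] := hyp_g_cont hN (y v) (sigma v) hg v0T e0.
have [|d3 d30 d3P] := solution_x_at ys kK' (conj kv v0a) (e := Num.min 1 d2).
  by rewrite lt_min ltr01.
(* The entry 1 gives the bound [M + 1], [d2] keeps [g] near its value at [v], and [eta / 2] and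
   [sigma v / 2], together with the same bounds on [s - v], keep [s - sigma s] below
   [v - sigma v + eta] and below [v]. *)
pose e4 := Num.min (Num.min 1 d2) (Num.min (eta / 2) (sigma v / 2)).
have e40 : 0 < e4 by rewrite !lt_min ltr01 d20 !divr_gt0.
have [d4 d40 d4P] := within_cont_ex (sol_tau_cont ys) v0a e40.
pose m := Num.min (Num.min d1 d2) (Num.min (Num.min d3 d4)
  (Num.min (alpha - v) (Num.min (eta / 2) (sigma v / 2)))).
have m0 : 0 < m by rewrite !lt_min d10 d20 d30 d40 subr_gt0 va !divr_gt0.
have mm : m <= m by [].
move: mm; rewrite {2}/m !le_min => /and3P[/andP[md1 md2] /andP[md3 md4]].
move=> /and3P[mda mde mds].
clearbody m; pose d := m / 2; have d0 : 0 < d by rewrite divr_gt0.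
have dm : d < m by rewrite ltr_pdivrMr// ltr_pMr// ltr1n.
have vda : v + d <= alpha by move: dm mda; clear_local; lra.
(* On the interval [g] differs from its value at [v] by less than [1 - g v (y v) (sigma v)], which
   bounds it by [B] in absolute value and also keeps it below 1. *)
pose B := `|g v (y v) (sigma v)| + (1 - g v (y v) (sigma v)).
have inI s : v <= s <= v + d -> impulse_itv T K t k s /\ `[0, alpha]%classic s.
  move=> /andP[vs sd]; split; first by apply: d1P; rewrite vs/=;
    move: sd dm md1; clear_local; lra.
  by rewrite /= in_itv/= (le_trans v0 vs) (le_trans sd vda).
have sv s : v <= s <= v + d -> `|s - v| < m.
  by move=> /andP[vs sd]; rewrite ger0_norm ?subr_ge0//; move: sd dm;
    clear_local; lra.
have nx s : v <= s <= v + d -> N (y s - y v) < Num.min 1 d2.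
  by move=> vsd; apply: (d3P s (inI s vsd)); apply: lt_le_trans (sv _ vsd) _.
have nt s : v <= s <= v + d -> `|sigma s - sigma v| < e4.
  by move=> vsd; apply: (d4P s (inI s vsd).2); apply: lt_le_trans (sv _ vsd) _.
have gd s : v <= s <= v + d ->
    `|g s (y s) (sigma s) - g v (y v) (sigma v)| < 1 - g v (y v) (sigma v).
  move=> vsd; have [_] := inI s vsd; rewrite /= in_itv/= => /andP[s0 sa].
  apply: d2P.
  - by rewrite s0 (le_trans sa).
  - exact: lt_le_trans (sv _ vsd) _.
  - by have := nx _ vsd; rewrite lt_min => /andP[].
  - by have := nt _ vsd; rewrite !lt_min => /andP[/andP[]].
have noimp r : v < r < v + d -> ~ impulse_times K t r.
  move=> /andP[vr rd]; have vrd : v <= r <= v + d by rewrite !ltW.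
  apply: (impulse_itv_not_impulse ht kK (inI _ vrd).1).
  by move/(impulse_itvE ht _ kK) : kv => [kv _ _]; exact: le_lt_trans vr.
have lip : forall s s', v <= s -> s <= s' -> s' <= v + d ->
    `|sigma s' - sigma s| <= B * (s' - s).
  apply: (solution_tau_lipschitz ys v0 vda noimp) => r /andP[vr rd].
  have /gd/ltW : v <= r <= v + d by rewrite !ltW.
  have := ler_normD (g v (y v) (sigma v))
    (g r (y r) (sigma r) - g v (y v) (sigma v)); rewrite addrC subrK /B;
      clear_local; lra.
have B0 : 0 <= B by rewrite addr_ge0// ltW.
exists d, B, k; split => //; split => // s vsd.
  split; first by have [] := inI s vsd.
    have := is_norm_le_dist hN (y s) (y v).
    by have := nx s vsd; rewrite lt_min => /andP[]; move: yM; clear_local; lra.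
  have := nt s vsd; rewrite !lt_min => /andP[/andP[+ _] _].
  have := ler_normD (sigma v) (sigma s - sigma v); rewrite addrC subrK.
  rewrite [X in _ <= X + _]gtr0_norm//; move: svM; clear_local; lra.
case/andP: (vsd) => vs sd; apply/andP; split; last first.
  have := nt s vsd; rewrite ltr_norml !lt_min => /andP[+ _].
  rewrite ltrNl !lt_min => /and3P[_ h1 h2].
  by move: h1 h2 vs sd dm mde mds; clear_local => *; apply/andP; split; lra.
(* The delayed argument does not fall below its value at [v]: as [g < 1] on the interval, [sigma]
   gains at most [s - v]. The bound is one-sided, hence the identity in place of a norm. *)
have : sigma s - sigma v <= 1 * (s - v).
  apply: (@abs_cont_increment_le R R^o idfun) => //=.
  - apply: abs_cont_lip B0 _ => r r' rr' rsub.
    have rvs : v <= r /\ r <= s.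
      by have := rsub r; rewrite /= !in_itv/= lexx rr' => /(_ isT)/andP[].
    have rvs' : v <= r' /\ r' <= s.
      by have := rsub r'; rewrite /= !in_itv/= lexx rr' => /(_ isT)/andP[].
    apply: le_trans (ler_norm _) _; apply: lip => //; first by case: rvs.
    by apply: le_trans sd; case: rvs'.
  - apply: ae_imply (sol_tau_eq ys) => r hr /andP[vr rs].
    have vrd : v <= r <= v + d by rewrite vr (le_trans (ltW rs)).
    have /hr : 0 <= r <= alpha by have [_] := inI r vrd; rewrite /= in_itv.
    move=> /is_deriveP/(expansion_within_sub (@subsetT _ [set q | r < q])) h.
    apply: (expansion_slope_le _ _ ltr01 _ _ h) => //.
    + by move=> u; rewrite mul1r; exact: ler_norm.
    + by have := gd r vrd; rewrite ltr_norml => /andP[_]; rewrite /=;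
      clear_local; lra.
by rewrite mul1r; clear_local; lra.
Qed.

Section Uniqueness.
Context {M1 M2 : R} {x y : R -> 'rV[R]_n} {tau sigma : R -> R}.
Hypothesis g_lt1 : forall (s : R) (u : 'rV[R]_n) (w : R),
  0 <= s <= alpha -> N u <= M1 -> 0 <= w <= M1 -> g s u w < 1.
Hypothesis xs : sol x tau.
Hypothesis tau_gt0 : forall s, 0 <= s <= alpha -> 0 < tau s.
Hypothesis xM1 : forall s, s <= alpha -> N (x s) + tau s <= M1.
Hypothesis M2_ge0 : 0 <= M2.
Hypothesis x_lip : forall (k : int) s s', k <= K%:Z ->
  impulse_itv T K t k s -> impulse_itv T K t k s' ->
  - M1 <= s <= alpha -> - M1 <= s' <= alpha ->
  N (x s - x s') <= M2 * `|s - s'|.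
Hypothesis ys : sol y sigma.

Let agree v := forall s, s <= v -> y s = x s /\ sigma s = tau s.

(* Just after v both delayed arguments stay in the interval between knots that
   contains v - tau v, because g < 1; there x is Lipschitz, so that the map
   defining the solutions contracts on a short interval. *)
Ltac clear_local ::= clear - hN ht hf hg alphaT sol
  g_lt1 xs tau_gt0 xM1 M2_ge0 x_lip ys agree.

Lemma solution_agree_step v : 0 <= v < alpha -> agree v ->
  exists2 w, v < w <= alpha & agree w.
Proof.
move=> v0a agv; have /andP[v0 va] := v0a.
have [alpha0 aT] := andP alphaT.
have v0a' : 0 <= v <= alpha by rewrite v0 ltW.
have tv0 := tau_gt0 v0a'.
have N0 u : 0 <= N u := is_norm_ge0 hN u.
have xv1 : N (x v) <= M1 by have := xM1 (ltW va); move: tv0; clear_local; lra.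
have tv1 : tau v <= M1 by have := xM1 (ltW va); have := N0 (x v); clear_local;
  lra.
have [yv sv] := agv v (lexx v).
pose p := v - tau v.
have pT : p < T by rewrite /p; move: tv0 va aT; clear_local; lra.
have pM1 : - M1 <= p by rewrite /p; move: tv1 v0; clear_local; lra.
have [j jK [jp _]] := impulse_itv_cover ht (ltW pT).
have [eta eta0 etaP] := impulse_itv_right ht jK jp pT.
have gv1 : g v (x v) (tau v) < 1 by apply: g_lt1 => //; rewrite (ltW tv0).
have tv0M : 0 < tau v <= M1 by rewrite tv0.
have [dx [Bx [k [dx0 dxa Bx0 kK [xloc xdel taulip]]]]] :=
  solution_local xs v0a xv1 tv0M gv1 eta0.
have yloc := @solution_local y sigma v eta M1 ys v0a.
rewrite yv sv in yloc.
have {yloc}[dy [By [ky [dy0 dya By0 kyK [yloc ydel siglip]]]]] :=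
  yloc xv1 tv0M gv1 eta0.
have M0 : 0 < M1 + 1 by move: tv0 tv1; clear_local; lra.
have [L1 L10 fL] := hf.2 _ M0.
have [_ _ /(_ _ M0)[L2 L20 gL]] := hg.
(* [L1 * (1 + M2)] and [L2 * 2] are the Lipschitz constants of the two right-hand sides in terms of
   a common bound on both differences; the factor [1 + M2] accounts for the shift of the delayed
   argument. The last 1 makes [C] positive, and [d] is chosen so that [C * d <= 1 / 2]. *)
pose C := L1 * (1 + M2) + L2 * 2 + 1.
have L1M : 0 <= L1 * (1 + M2) by rewrite mulr_ge0// addr_ge0.
have C0 : 0 < C by rewrite /C; move: L1M L20; clear_local; lra.
pose d := Num.min (Num.min dx dy) (2 * C)^-1.
have d0 : 0 < d by rewrite !lt_min dx0 dy0 invr_gt0 mulr_gt0.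
have dd : d <= d by [].
move: dd; rewrite {2}/d !le_min => /andP[/andP[ddx ddy] dC].
have Cd : C * d <= 2^-1.
  apply: (@le_trans _ _ (C * (2 * C)^-1)); first by rewrite ler_wpM2l// ltW.
  by rewrite invfM mulrCA mulfV ?mulr1// gt_eqF.
have vsx s : v <= s <= v + d -> v <= s <= v + dx.
  by move=> /andP[-> /le_trans->//]; rewrite lerD2l.
have vsy s : v <= s <= v + d -> v <= s <= v + dy.
  by move=> /andP[-> /le_trans->//]; rewrite lerD2l.
have vs0a s : v <= s <= v + d -> 0 <= s <= alpha.
  by move=> /andP[vs sd];
    rewrite (le_trans v0 vs) (le_trans sd)// (le_trans _ dxa)// lerD2l.
(* Both delayed arguments lie before [v], where the solutions agree. Hence only values of [x] are
   compared, within one interval between knots. *)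
have delayed s : v <= s <= v + d -> [/\ y (s - sigma s) = x (s - sigma s),
    N (x (s - sigma s)) <= M1 + 1, N (x (s - tau s)) <= M1 + 1
    & N (x (s - sigma s) - x (s - tau s)) <= M2 * `|sigma s - tau s|].
  move=> vsd; have := xdel s (vsx s vsd); have := ydel s (vsy s vsd).
  rewrite !lt_min => /and3P[ps sv1 seta] /and3P[pt tv' teta].
  have sa : s - sigma s <= alpha by exact: le_trans (ltW sv1) (ltW va).
  have ta : s - tau s <= alpha by exact: le_trans (ltW tv') (ltW va).
  have tge r : r <= alpha -> 0 <= tau r.
    move=> ra; have [r0|/ltW r0] := leP r 0; last by rewrite ltW// tau_gt0// r0.
    rewrite (sol_tau_init xs r0) -(sol_tau_init xs (lexx 0)).
    by rewrite ltW// tau_gt0// lexx ltW.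
  split.
  - by have [] := agv (s - sigma s) (ltW sv1).
  - by have := xM1 sa; have := tge _ sa; clear_local; lra.
  - by have := xM1 ta; have := tge _ ta; clear_local; lra.
  - have -> : `|sigma s - tau s| = `|(s - sigma s) - (s - tau s)|.
      by rewrite -normrN; congr (`|_|); ring.
    apply: (x_lip jK).
    + by apply: etaP; rewrite ps.
    + by apply: etaP; rewrite pt.
    + by rewrite (le_trans pM1 ps).
    + by rewrite (le_trans pM1 pt).
have contract B : 0 <= B -> (forall s, v <= s <= v + d ->
      N (y s - x s) <= B /\ `|sigma s - tau s| <= B) ->
    forall s, v <= s <= v + d ->
      N (y s - x s) <= B / 2 /\ `|sigma s - tau s| <= B / 2.
  move=> B0 dB s vsd; have /andP[vs sd] := vsd.
  have sub r : v <= r <= s -> v <= r <= v + d.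
    by move=> /andP[-> /le_trans->].
  have half L : 0 <= L -> L <= C -> L * B * (s - v) <= B / 2.
    move=> L0 LC; rewrite mulrAC mulrC ler_wpM2l//.
    apply: le_trans Cd; apply: ler_pM => //; first by rewrite subr_ge0.
    by rewrite lerBlDl.
  have L1C : L1 * (1 + M2) <= C by rewrite /C; move: L20; clear_local; lra.
  have L2C : L2 * 2 <= C by rewrite /C; move: L1M; clear_local; lra.
  split.
    apply: le_trans (half _ L1M L1C).
    have -> : y s - x s = (y s - x s) - (y v - x v) by rewrite yv subrr subr0.
    apply: (@abs_cont_increment_le R _ N (is_normD hN) (y \- x)) => //.
    + by rewrite mulr_ge0.
    + apply: (abs_contD (is_normD hN)).
        apply: abs_cont_sub (sol_ac ys kK) => r; rewrite /= !in_itv/= => vrs.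
        by split; [have [] := xloc r (vsx r (sub r vrs))|exact: vs0a (sub r
          vrs)].
      apply: (abs_contN (is_normN hN)).
      apply: abs_cont_sub (sol_ac xs kK) => r; rewrite /= !in_itv/= => vrs.
      by split; [have [] := xloc r (vsx r (sub r vrs))|exact: vs0a (sub r vrs)].
    + apply: (ae_imply2 _ (sol_x_eq xs) (sol_x_eq ys)) => r hx hy /andP[vr rs].
      have vrd : v <= r <= v + d by apply: sub; rewrite vr ltW.
      have [_ /is_deriveP dxr] := hx (vs0a r vrd).
      have [_ /is_deriveP dyr] := hy (vs0a r vrd).
      have := expansion_withinB dyr dxr.
      move=> /(expansion_within_sub (@subsetT _ [set q | r < q])) h.
      have [C1 C10 NC] := is_norm_le_mx_norm hN.
      apply: (expansion_slope_le (is_normD hN) _ C10 NC _ h).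
        by move=> a u a0; rewrite (is_normZ hN) ger0_norm.
      have [-> Mys Mxt dl] := delayed r vrd.
      have [Br Bt] := dB r vrd.
      have [_ yrM _] := yloc r (vsy r vrd).
      have [_ xrM _] := xloc r (vsx r vrd).
      apply: le_trans (fL _ _ _ _ _ _ yrM xrM Mys Mxt) _.
        by case/andP: (vs0a r vrd) => -> /le_trans->.
      rewrite -mulrA ler_wpM2l// mulrDl mul1r lerD//.
      by apply: (le_trans dl); rewrite ler_wpM2l.
  apply: le_trans (half _ (mulr_ge0 L20 _) L2C) => //.
  have -> : sigma s - tau s = (sigma s - tau s) - (sigma v - tau v).
    by rewrite sv subrr subr0.
  apply: (@abs_cont_increment_le R R^o (fun u => `|u|) (@ler_normD _ _)
    (sigma \- tau)) => //.
  + by rewrite mulr_ge0// mulr_ge0.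
  + apply: (@abs_cont_lip _ R^o _ _ _ (By + Bx)); first exact: addr_ge0.
    move=> r r' rr' rsub.
    have : v <= r <= s by have := rsub r; rewrite /= !in_itv/= lexx rr'; apply.
    have : v <= r' <= s by have := rsub r'; rewrite /= !in_itv/= lexx rr';
      apply.
    move=> /sub vr' /sub vr.
    have /andP[_ r'x] := vsx r' vr'; have /andP[_ r'y] := vsy r' vr'.
    have /andP[vr1 _] := vr.
    rewrite /= subrACA; apply: (le_trans (ler_normB _ _));
      rewrite mulrDl lerD//.
      exact: siglip.
    exact: taulip.
  + apply: (ae_imply2 _ (sol_tau_eq xs) (sol_tau_eq ys)) => r hx hy /andP[vr
    rs].
    have vrd : v <= r <= v + d by apply: sub; rewrite vr ltW.
    have /is_deriveP dxr := hx (vs0a r vrd).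
    have /is_deriveP dyr := hy (vs0a r vrd).
    have := expansion_withinB dyr dxr.
    move=> /(expansion_within_sub (@subsetT _ [set q | r < q])) h.
    apply: (expansion_slope_le (@ler_normD _ R) _ ltr01 _ _ h).
    * by move=> a u a0; rewrite normrM ger0_norm.
    * by move=> u; rewrite mul1r.
    have [Br Bt] := dB r vrd.
    have [_ yrM] := yloc r (vsy r vrd); rewrite ler_norml => sM.
    have [_ xrM] := xloc r (vsx r vrd); rewrite ler_norml => tM.
    apply: le_trans (gL _ _ _ _ _ _ yrM xrM sM tM) _.
      by case/andP: (vs0a r vrd) => -> /le_trans->.
    by rewrite -mulrA ler_wpM2l// mulr_natl mulr2n lerD.
(* The bounds [M1 + 1] on both solutions start the iteration; each further step halves the bound. *)
have iter (m : nat) s : v <= s <= v + d ->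
    N (y s - x s) <= (2 * (M1 + 1)) / 2 ^+ m /\
    `|sigma s - tau s| <= (2 * (M1 + 1)) / 2 ^+ m.
  elim: m s => [|m IH] s vsd; last first.
    rewrite exprSr invfM mulrA; apply: contract => //.
    by rewrite divr_ge0 ?exprn_ge0// mulr_ge0// ltW.
  have [_ ysM ssM] := yloc s (vsy s vsd).
  have [_ xsM tsM] := xloc s (vsx s vsd).
  rewrite expr0 divr1; split.
    by have := is_normB hN (y s) (x s); move: ysM xsM; clear_local; lra.
  by have := ler_normB (sigma s) (tau s); move: ssM tsM; clear_local; lra.
exists (v + d); first by rewrite ltrDl d0/= (le_trans _ dxa)// lerD2l.
move=> s sd; have [sv'|/ltW vs] := leP s v; first exact: agv.
have vsd : v <= s <= v + d by rewrite vs.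
have M20 : 0 <= 2 * (M1 + 1) by rewrite mulr_ge0// ltW.
split; apply/eqP; rewrite -subr_eq0.
  apply/eqP; case: hN => _ _; apply; apply/eqP; rewrite eq_le N0 andbT.
  by apply: (le0_halving M20) => m; have [] := iter m s vsd.
rewrite -normr_le0.
by apply: (le0_halving M20) => m; have [] := iter m s vsd.
Qed.

(** The delays agree at [v] by continuity. At an impulse time the left limits coincide and the jump
    relation determines the value; at any other [v] the interval between impulses extends to the
    left of [v], and continuity on it decides. *)
Lemma solution_agree_closed v : 0 < v <= alpha ->
  (forall s, 0 <= s < v -> agree s) -> agree v.
Proof.
move=> /andP[v0 va] agv; have [alpha0 aT] := andP alphaT.
have ag s : s < v -> y s = x s /\ sigma s = tau s.
  move=> sv; have [s0|/ltW s0] := leP 0 s; last first.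
    by rewrite (sol_x_init xs s0) (sol_x_init ys s0) (sol_tau_init xs s0)
      (sol_tau_init ys s0).
  by apply: (agv s) => //; rewrite s0.
suff [yv sv] : y v = x v /\ sigma v = tau v.
  by move=> s; rewrite le_eqVlt => /orP[/eqP->|/ag].
have v0a : `[0, alpha]%classic v by rewrite /= in_itv/= (ltW v0).
have left (P : R -> Prop) (d : R) : 0 < d ->
    (forall s, 0 <= s -> s < v -> v - d < s -> P s) -> exists2 s, s < v & P s.
  move=> d0 dP; pose s := Num.max 0 (v - d / 2).
  have d2 : 0 < d / 2 by rewrite divr_gt0.
  have d2d : d / 2 < d by rewrite ltr_pdivrMr// ltr_pMr// ltr1n.
  have sv : s < v by rewrite gt_max v0/=; move: d2; clear_local; lra.
  exists s => //; apply: dP => //; first by rewrite le_max lexx.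
  by rewrite lt_max; apply/orP; right; move: d2 d2d; clear_local; lra.
split; last first.
  apply/eqP; rewrite -subr_eq0 -normr_le0; apply/ler_addgt0Pr => e e0.
  have e20 : 0 < e / 2 by rewrite divr_gt0.
  have [d1 d10 d1P] := within_cont_ex (sol_tau_cont ys) v0a e20.
  have [d2 d20 d2P] := within_cont_ex (sol_tau_cont xs) v0a e20.
  have [||s sv [s1 s2]] := left (fun s => `|sigma s - sigma v| < e / 2 /\
      `|tau s - tau v| < e / 2) (Num.min d1 d2).
  - by rewrite lt_min d10.
  - move=> s s0 sv vs.
    have s0a : `[0, alpha]%classic s.
      by rewrite /= in_itv/= s0 (le_trans (ltW sv)).
    have : `|s - v| < Num.min d1 d2.
      by rewrite ltr0_norm ?subr_lt0// opprB ltrBlDl -ltrBlDr.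
    rewrite lt_min => /andP[h1 h2].
    by split; [exact: d1P|exact: d2P].
  have [_ st] := ag s sv; rewrite st in s1.
  have -> : sigma v - tau v = (tau s - tau v) - (tau s - sigma v).
    by ring.
  by have := ler_normB (tau s - tau v) (tau s - sigma v); move: s1 s2;
    clear_local; lra.
have [[i /andP[i1 iK] vE]|noimp] := pselect (impulse_times K t v).
  have ikK : (1 <= i <= K)%N by rewrite i1.
  have iv : t i%:Z <= alpha by rewrite -vE.
  have [_ ] := sol_impulse xs ikK iv; have [_] := sol_impulse ys ikK iv.
  rewrite -vE; have -> : lim (y @ v^'-) = lim (x @ v^'-).
    congr (lim _); apply/seteqP; split; apply: near_eq_cvg;
      by near=> r; have [|-> //] := ag r; near: r; exact: nbhs_left_lt.
  by move=> <- /esym/addIr ->.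
have vT : v <= T by exact: le_trans aT.
have [k' kK [kv /(_ (ltW v0)) k0]] := impulse_itv_cover ht vT.
case: k' kK kv k0 => // k kK kv _; have kK' : (k <= K)%N by exact: kK.
have vk : v != t k%:Z.
  apply/eqP => vE; case: (posnP k) => [k0|k1]; last first.
    by apply: noimp; exists k => //; rewrite k1.
  by move: v0; rewrite vE k0; case: ht => -> _ _ _; rewrite ltxx.
have [d3 d30 d3P] := impulse_itv_left ht kK kv vk.
apply/eqP; rewrite -subr_eq0; apply/eqP; case: (hN) => _ _; apply.
apply/eqP; rewrite eq_le (is_norm_ge0 hN) andbT; apply/ler_addgt0Pr => e e0.
have e20 : 0 < e / 2 by rewrite divr_gt0.
have [d1 d10 d1P] := solution_x_at ys kK' (conj kv v0a) e20.
have [d2 d20 d2P] := solution_x_at xs kK' (conj kv v0a) e20.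
have [||s sv [s1 s2]] := left (fun s => N (y s - y v) < e / 2 /\
    N (x s - x v) < e / 2) (Num.min d3 (Num.min d1 d2)).
- by rewrite !lt_min d10 d30.
- move=> s s0 sv vs.
  have s0a : `[0, alpha]%classic s.
    by rewrite /= in_itv/= s0 (le_trans (ltW sv)).
  have : `|s - v| < Num.min d3 (Num.min d1 d2).
    by rewrite ltr0_norm ?subr_lt0// opprB ltrBlDl -ltrBlDr.
  rewrite !lt_min => /and3P[h3 h1 h2].
  have ks : impulse_itv T K t k%:Z s.
    apply: d3P; rewrite (ltW sv) andbT.
    by move: h3; rewrite ltr0_norm ?subr_lt0//; clear_local; lra.
  by split; [apply: d1P|apply: d2P].
have [st _] := ag s sv; rewrite st in s1.
have := is_norm_distD hN (x s) (y v) (x v).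
rewrite (is_norm_distC hN (y v) (x s)); move: s1 s2; clear_local; lra.
Unshelve. all: by end_near. Qed.

Lemma solution_unique : agree alpha.
Proof.
have [alpha0 aT] := andP alphaT.
apply: (real_induction (ltW alpha0)).
- move=> s s0; rewrite (sol_x_init xs s0) (sol_x_init ys s0).
  by rewrite (sol_tau_init xs s0) (sol_tau_init ys s0).
- move=> v v0 agv; have [w vw agw] := solution_agree_step v0 agv.
  exists w => // s /andP[_ sw] r rs; apply: agw; exact: le_trans sw.
- exact: solution_agree_closed.
Qed.

End Uniqueness.
End Solutions.

(** * Meshes and one-sided limits *)

Lemma mesh_floor_le (R : realType) (h s : R) : 0 < h -> mesh_floor h s <= s.
Proof. by move=> h0; rewrite /mesh_floor -ler_pdivlMr// floor_le. Qed.

Lemma mesh_floor_gt (R : realType) (h s : R) : 0 < h -> s - h < mesh_floor h s.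
Proof.
move=> h0; rewrite /mesh_floor ltrBlDr -[X in _ + X]mul1r -mulrDl.
by rewrite -ltr_pdivrMr// -intrD1 floorD1_gt.
Qed.

Lemma mesh_floor_ge0 (R : realType) (h s : R) : 0 < h -> 0 <= s ->
  0 <= mesh_floor h s.
Proof.
by move=> h0 s0; rewrite mulr_ge0 ?(ltW h0)// ler0z floor_ge0 divr_ge0// ltW.
Qed.

(** The values near [v] are Cauchy by the Lipschitz bound. The rate depends on [L] only, so it is
    common to all schemes and their limit; this is what permits exchanging left limits with the
    limit in [h]. *)
Lemma lipschitz_left_cvg (R : realType) (m : nat) (N : 'rV[R]_m -> R)
    (F : R -> 'rV[R]_m) (a v L : R) : is_norm N -> a < v -> 0 <= L ->
  (forall s s', a <= s < v -> a <= s' < v -> N (F s - F s') <= L * `|s - s'|) ->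
  exists2 l : 'rV[R]_m, F @ v^'- --> l &
    forall s, a <= s < v -> N (F s - l) <= L * (v - s).
Proof.
move=> hN av L0 FL.
have [c c0 cN] := mx_norm_le_is_norm hN.
have [C C0 NC] := is_norm_le_mx_norm hN.
have cF : cvg (F @ v^'-).
  apply: cauchy_cvg; apply: cauchy_exP => e e0.
  pose d := Num.min (v - a) (e / (c * L + 1)).
  have cL0 : 0 <= c * L by rewrite mulr_ge0// ltW.
  have cL : 0 < c * L + 1 by rewrite ltr_wpDl.
  have d0 : 0 < d by rewrite lt_min subr_gt0 av divr_gt0.
  have dva : d <= v - a by rewrite ge_min lexx.
  have de : (c * L + 1) * d <= e.
    by rewrite -ler_pdivlMl// mulrC ge_min lexx orbT.
  have d2 : 0 < d / 2 by rewrite divr_gt0.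
  pose s1 := v - d / 2; exists (F s1); apply/at_left_ex.
  exists (d / 2) => // s /andP[s1s sv]; rewrite -ball_normE/=.
  apply: le_lt_trans (cN _) _; apply: lt_le_trans de.
  have s1v : s1 < v by rewrite /s1 ltrBlDr ltrDl.
  have as1 : a <= s1 by move: dva d2; rewrite /s1; clear; lra.
  apply: (@le_lt_trans _ _ (c * (L * `|s1 - s|))).
    rewrite ler_wpM2l ?(ltW c0)// FL// ?as1 ?s1v//.
    by rewrite sv (le_trans as1 (ltW s1s)).
  rewrite ltr0_norm ?subr_lt0// opprB mulrA.
  apply: (@le_lt_trans _ _ (c * L * d)).
    by rewrite ler_wpM2l//; move: sv d2; rewrite /s1; clear; lra.
  by rewrite ltr_pM2r// ltrDl.
exists (lim (F @ v^'-)) => // s /andP[as_ sv]; apply/ler_addgt0Pr => e e0.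
have eC : 0 < e / C by rewrite divr_gt0.
move/cvgrPdist_lt : (cF) => /(_ _ eC)/at_left_ex[d d0 dP].
pose r := Num.max s (v - d / 2).
have d2 : 0 < d / 2 by rewrite divr_gt0.
have rv : r < v by rewrite gt_max sv/= ltrBlDr ltrDl.
have sr : s <= r by rewrite le_max lexx.
have vr : v - d < r.
  by rewrite lt_max; apply/orP; right; move: d2; clear; lra.
apply: le_trans (is_norm_distD hN (F r) _ _) _; apply: lerD.
  apply: le_trans (FL _ _ _ _) _; rewrite ?as_ ?sv ?rv ?(le_trans as_ sr)//.
  rewrite ler_wpM2l// distrC ger0_norm ?subr_ge0//.
  by rewrite lerB// ltW.
rewrite (is_norm_distC hN); apply: le_trans (NC _) _.
by rewrite mulrC -ler_pdivlMr//; apply/ltW/dP; rewrite vr.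
Qed.

(** * Limits of scheme solutions *)

Definition mesh_delayed (R : realType) (h : R) (sigma : R -> R) (r : R) : R :=
  mesh_floor h r - mesh_floor h (sigma (mesh_floor h r)).

Lemma expansion_interior (R : realType) (V : normedModType R) (F : R -> V)
    (a b s : R) (D : V) :
  expansion_within `[a, b] F s D -> a < s < b -> expansion_within setT F s D.
Proof.
move=> h /andP[as_ sb] e e0; have [d d0 dP] := h e e0.
exists (Num.min d (Num.min (s - a) (b - s))).
  by rewrite !lt_min d0 !subr_gt0 as_.
move=> r _; rewrite !lt_min => /and3P[rd ra rb]; apply: dP => //.
move: ra rb; rewrite !ltr_norml /= in_itv/=; clear => /andP[? ?] /andP[? ?].
by apply/andP; split; lra.
Qed.

Section Existence.
Context {R : realType} {n : nat} {N : 'rV[R]_n -> R} {T : R} {K : nat}.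
Context {t : int -> R} {f : R -> 'rV[R]_n -> 'rV[R]_n -> 'rV[R]_n}.
Context {g : R -> 'rV[R]_n -> R -> R} {I : nat -> 'rV[R]_n -> 'rV[R]_n}.
Context {phi : R -> 'rV[R]_n} {lambda alpha hstar M1 M2 M3 : R}.
Implicit Types (h s r a b d e p q : R).
Hypothesis hN : is_norm N.
Hypothesis ht : knot_sequence T K t.
Hypothesis hf : hyp_f N T f.
Hypothesis hg : hyp_g N T g.
Hypothesis hI : hyp_I N K I.
Hypothesis lambda_gt0 : 0 < lambda.
Hypothesis alphaT : 0 < alpha <= T.
Hypothesis M2_ge0 : 0 <= M2.
Hypothesis M3_ge0 : 0 <= M3.
Hypothesis g_lt1 : forall (s : R) (u : 'rV[R]_n) (w : R),
  0 <= s <= alpha -> N u <= M1 -> 0 <= w <= M1 -> g s u w < 1.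
Context {X : R -> R -> 'rV[R]_n} {Y : R -> R -> R}.
Hypothesis XY_scheme : forall h : R, 0 < h < hstar ->
  scheme_solution T K t f g I phi lambda alpha h (X h) (Y h).
Hypothesis Y_gt0 : forall h : R, 0 < h < hstar ->
  forall s, 0 <= s <= alpha -> 0 < Y h s.
Hypothesis XY_lt : forall h : R, 0 < h < hstar ->
  forall s, s <= alpha -> N (X h s) + Y h s < M1.
Hypothesis X_lip : forall h : R, 0 < h < hstar -> forall (k : int) s s', k <=
  K%:Z ->
  impulse_itv T K t k s -> impulse_itv T K t k s' ->
  - M1 <= s <= alpha -> - M1 <= s' <= alpha ->
  N (X h s - X h s') <= M2 * `|s - s'|.
Hypothesis Y_lip : forall h : R, 0 < h < hstar -> forall s s',
  0 <= s <= alpha -> 0 <= s' <= alpha -> `|Y h s - Y h s'| <= M3 * `|s - s'|.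
Context {x : R -> 'rV[R]_n} {tau : R -> R}.
(** Convergence enters only in this form: finitely many times are served by one common mesh size, as
    small as desired. *)
Hypothesis approximation : forall (l : seq R) (d e : R), 0 < d -> 0 < e ->
  (forall s, s \in l -> s <= alpha) ->
  exists h : R, [/\ h < d, 0 < h < hstar &
    forall s, s \in l -> N (X h s - x s) < e /\ `|Y h s - tau s| < e].

Let N0 u : 0 <= N u. Proof. exact: is_norm_ge0. Qed.

Let alpha_gt0 : 0 < alpha. Proof. by case/andP: alphaT. Qed.

Let alpha_leT : alpha <= T. Proof. by case/andP: alphaT. Qed.

Ltac clear_local := clear - hN ht hf hg hI lambda_gt0 alphaT
  M2_ge0 M3_ge0 g_lt1 XY_scheme Y_gt0 XY_lt X_lip Y_lip approximation
  N0 alpha_gt0 alpha_leT.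

(** * Bounds inherited by the limit *)

Lemma approximation1 s e : 0 < e -> s <= alpha -> exists h : R, [/\ 0 < h <
  hstar,
  N (X h s - x s) < e & `|Y h s - tau s| < e].
Proof.
move=> e0 sa; have [|h [_ hh /(_ s)]] := @approximation [:: s] 1 e ltr01 e0.
  by move=> r; rewrite inE => /eqP ->.
by rewrite mem_head => /(_ isT)[]; exists h.
Qed.

Lemma approximation2 s s' e : 0 < e -> s <= alpha -> s' <= alpha ->
  exists h : R, [/\ 0 < h < hstar,
  N (X h s - x s) < e /\ `|Y h s - tau s| < e &
  N (X h s' - x s') < e /\ `|Y h s' - tau s'| < e].
Proof.
move=> e0 sa sa'.
have [|h [_ hh hP]] := @approximation [:: s; s'] 1 e ltr01 e0.
  by move=> r; rewrite !inE => /orP[] /eqP ->.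
by exists h; split => //; apply: hP; rewrite !inE eqxx ?orbT.
Qed.

Lemma Y_ge0 h s : 0 < h < hstar -> s <= alpha -> 0 <= Y h s.
Proof.
move=> hh sa; have [s0|/ltW s0] := leP 0 s; first by rewrite ltW// Y_gt0// s0.
by rewrite (sch_tau_init (XY_scheme hh) s0) ltW.
Qed.

Lemma M1_ge0 h : 0 < h < hstar -> 0 <= M1.
Proof.
move=> hh; have := XY_lt hh (lexx _); have := N0 (X h alpha).
by have := Y_ge0 hh (lexx _); clear_local; lra.
Qed.

Lemma limit_bound s : s <= alpha -> N (x s) + tau s <= M1.
Proof.
move=> sa; apply/ler_addgt0Pr => e e0; have e20 : 0 < e / 2 by rewrite divr_gt0.
have [h [hh h1 h2]] := approximation1 e20 sa.
have := XY_lt hh sa; have := is_norm_le_dist hN (x s) (X h s).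
rewrite (is_norm_distC hN) => h3; move: h2; rewrite ltr_norml => /andP[h2 _].
by move: h1 h2 h3; clear_local; lra.
Qed.

Lemma limit_tau_ge0 s : s <= alpha -> 0 <= tau s.
Proof.
move=> sa; apply/ler_addgt0Pr => e e0; have [h [hh _]] := approximation1 e0 sa.
have := Y_ge0 hh sa.
by rewrite ltr_norml => + /andP[_]; clear_local; lra.
Qed.

Lemma limit_tau_lip s s' : 0 <= s <= alpha -> 0 <= s' <= alpha ->
  `|tau s - tau s'| <= M3 * `|s - s'|.
Proof.
move=> s0 s0'; apply/ler_addgt0Pr => e e0.
have e20 : 0 < e / 2 by rewrite divr_gt0.
have [||h [hh [_ h1] [_ h2]]] := @approximation2 s s' _ e20;
  try by [case/andP: s0 | case/andP: s0'].
have := Y_lip hh s0 s0'; have := ler_distD (Y h s) (tau s) (tau s').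
have := ler_distD (Y h s') (Y h s) (tau s').
by move: h1 h2; rewrite (distrC (Y h s) (tau s)); clear_local; lra.
Qed.

Lemma limit_x_lip (k : int) s s' : k <= K%:Z ->
  impulse_itv T K t k s -> impulse_itv T K t k s' ->
  - M1 <= s <= alpha -> - M1 <= s' <= alpha ->
  N (x s - x s') <= M2 * `|s - s'|.
Proof.
move=> kK ks ks' s0 s0'; apply/ler_addgt0Pr => e e0.
have e20 : 0 < e / 2 by rewrite divr_gt0.
have [||h [hh [h1 _] [h2 _]]] := @approximation2 s s' _ e20;
  try by [case/andP: s0 | case/andP: s0'].
have := X_lip hh kK ks ks' s0 s0';
  have := is_norm_distD hN (X h s) (x s) (x s').
have := is_norm_distD hN (X h s') (X h s) (x s').
by move: h1 h2; rewrite (is_norm_distC hN (X h s) (x s)); clear_local; lra.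
Qed.

Lemma limit_x_init s : s <= 0 -> x s = phi s.
Proof.
move=> s0; have sa : s <= alpha by rewrite (le_trans s0)// ltW.
apply/eqP; rewrite -subr_eq0; apply/eqP; case: (hN) => _ _; apply.
apply/eqP; rewrite eq_le N0 andbT; apply/ler_addgt0Pr => e e0.
have [h [hh h1 _]] := approximation1 e0 sa.
rewrite -(sch_x_init (XY_scheme hh) s0) (is_norm_distC hN) add0r; exact: ltW.
Qed.

Lemma limit_tau_init s : s <= 0 -> tau s = lambda.
Proof.
move=> s0; have sa : s <= alpha by rewrite (le_trans s0)// ltW.
apply/eqP; rewrite -subr_eq0 -normr_le0; apply/ler_addgt0Pr => e e0.
have [h [hh _ h1]] := approximation1 e0 sa.
rewrite -(sch_tau_init (XY_scheme hh) s0) distrC add0r; exact: ltW.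
Qed.

(** * Increments of the scheme solutions *)

Lemma X_right h r : 0 < h < hstar -> 0 <= r < alpha ->
  expansion_within [set q | r < q] (X h) r
    (f (mesh_floor h r) (X h (mesh_floor h r)) (X h (mesh_delayed h (Y h) r))).
Proof.
move=> hh r0; have [_ [nS S]] := sch_x_eq (XY_scheme hh) r0.
have [/S /right_derivativeP//|/nS /is_deriveP] :=
  pselect ((mesh h `|` impulse_times K t) r).
exact: expansion_within_sub.
Qed.

Lemma Y_right h r : 0 < h < hstar -> 0 <= r < alpha ->
  @expansion_within R R^o [set q | r < q] (Y h) r
    (g (mesh_floor h r) (X h (mesh_floor h r)) (Y h (mesh_floor h r))).
Proof.
move=> hh r0; have [nS S] := sch_tau_eq (XY_scheme hh) r0.
have [/S /right_derivativeP//|/nS /is_deriveP] :=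
  pselect ((mesh h `|` impulse_times K t) r).
exact: expansion_within_sub.
Qed.

(** Subtracting the linear map with slope [D] turns closeness of all right slopes to [D] into a
    bound on the increment. Both ends lie in one interval between impulses, since [X h] may jump
    elsewhere. *)
Lemma X_increment h (k : nat) a b D e : 0 < h < hstar -> (k <= K)%N -> a <= b ->
  impulse_itv T K t k%:Z a -> impulse_itv T K t k%:Z b ->
  0 <= a -> b <= alpha -> 0 <= e ->
  (forall r, a <= r < b ->
    N (f (mesh_floor h r) (X h (mesh_floor h r)) (X h (mesh_delayed h (Y h) r))
      - D) <= e) ->
  N (X h b - X h a - (b - a) *: D) <= e * (b - a).
Proof.
move=> hh kK ab ka kb a0 ba e0 fe.
have [C C0 NC] := is_norm_le_mx_norm hN.
have := @abs_cont_increment_le R _ N (is_normD hN) (fun r => X h r - r *: D)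
  a b e ab e0.
rewrite subrACA -scalerBl; apply.
- apply: (@abs_cont_lip _ _ _ _ _ (M2 + N D)); first by rewrite addr_ge0.
  move=> s s' ss' sub.
  have : `[s, s']%classic s by rewrite /= in_itv/= lexx.
  have : `[s, s']%classic s' by rewrite /= in_itv/= lexx ss'.
  move=> /sub; rewrite /= in_itv/= => abs' /sub; rewrite /= in_itv/= => abs.
  have lim r : a <= r <= b -> - M1 <= r <= alpha.
    move=> /andP[ar rb]; rewrite (le_trans rb ba) andbT.
    by rewrite (le_trans _ (le_trans a0 ar))// oppr_le0 (M1_ge0 hh).
  rewrite subrACA -scalerBl mulrDl; apply: (le_trans (is_normB hN _ _)).
  rewrite (is_normZ hN) ger0_norm ?subr_ge0// [_ * N D]mulrC lerD2r.
  rewrite -[s' - s]ger0_norm ?subr_ge0//.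
  apply: (X_lip hh (k := k%:Z)) => //; try exact: lim.
    exact: (impulse_itv_convex ht _ ka kb).
  exact: (impulse_itv_convex ht _ ka kb).
- apply: aeW => r /andP[ar rb].
  have := X_right hh (r := r); rewrite (le_trans a0 ar) (lt_le_trans rb ba).
  move=> /(_ isT) /expansion_withinB/(_ (@expansion_within_linear _ _ _ D r)).
  apply: (expansion_slope_le (is_normD hN) _ C0 NC).
    by move=> c u c0; rewrite (is_normZ hN) ger0_norm.
  by apply: fe; rewrite ar.
Qed.

Lemma Y_increment h a b D e : 0 < h < hstar -> a <= b ->
  0 <= a -> b <= alpha -> 0 <= e ->
  (forall r, a <= r < b ->
    `|g (mesh_floor h r) (X h (mesh_floor h r)) (Y h (mesh_floor h r)) - D| <=
      e) ->
  `|Y h b - Y h a - (b - a) * D| <= e * (b - a).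
Proof.
move=> hh ab a0 ba e0 ge.
have := @abs_cont_increment_le R R^o (fun u => `|u|) (@ler_normD _ _)
  (fun r => Y h r - r * D) a b e ab e0.
rewrite subrACA -mulrBl; apply.
- apply: (@abs_cont_lip _ R^o _ _ _ (M3 + `|D|)); first by rewrite addr_ge0.
  move=> s s' ss' sub.
  have : `[s, s']%classic s by rewrite /= in_itv/= lexx.
  have : `[s, s']%classic s' by rewrite /= in_itv/= lexx ss'.
  move=> /sub; rewrite /= in_itv/= => /andP[as_' sb'] /sub.
  rewrite /= in_itv/= => /andP[as_ sb].
  rewrite subrACA -mulrBl [leRHS]mulrDl.
  apply: (le_trans (ler_normB _ _)).
  rewrite normrM ger0_norm ?subr_ge0// [_ * `|D|]mulrC lerD2r.
  rewrite -[s' - s]ger0_norm ?subr_ge0//.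
  by apply: Y_lip => //; rewrite ?(le_trans a0)//= (le_trans _ ba).
- apply: aeW => r /andP[ar rb].
  have := Y_right hh (r := r); rewrite (le_trans a0 ar) (lt_le_trans rb ba).
  move=> /(_ isT) /expansion_withinB
    /(_ (@expansion_within_linear R R^o _ (D : R^o) r)).
  apply: (expansion_slope_le (@ler_normD _ R) _ ltr01).
  + by move=> c u c0; rewrite normrM ger0_norm.
  + by move=> u; rewrite mul1r.
  + by apply: ge; rewrite ar.
Qed.

(** Every right slope of [Y h] is a value of [g] at a mesh point of [[0, alpha]], where the scheme
    obeys the bound [M1], so that [g_lt1] applies. *)
Lemma Y_increment_le h a b : 0 < h < hstar -> 0 <= a -> a <= b -> b <= alpha ->
  Y h b - Y h a <= b - a.
Proof.
move=> hh a0 ab ba; have /andP[h0 _] := hh; rewrite -[leRHS]mul1r.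
apply: (@abs_cont_increment_le R R^o idfun _ (Y h)) => //.
- apply: (@abs_cont_lip _ R^o _ _ _ M3) => // s s' ss' sub.
  have : `[s, s']%classic s by rewrite /= in_itv/= lexx.
  have : `[s, s']%classic s' by rewrite /= in_itv/= lexx ss'.
  move=> /sub; rewrite /= in_itv/= => /andP[as_' sb'] /sub.
  rewrite /= in_itv/= => /andP[as_ sb].
  apply: le_trans (ler_norm _) _; rewrite -[s' - s]ger0_norm ?subr_ge0//.
  by apply: Y_lip => //; rewrite ?(le_trans a0)//= (le_trans _ ba).
- apply: aeW => r /andP[ar rb].
  have r0 : 0 <= r by exact: le_trans ar.
  have ra : r < alpha by exact: lt_le_trans ba.
  have := Y_right hh (r := r); rewrite r0 ra => /(_ isT).
  apply: (expansion_slope_le _ _ ltr01) => //.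
    by move=> u; rewrite mul1r; exact: ler_norm.
  have fa : mesh_floor h r <= alpha by exact: le_trans (mesh_floor_le r h0)
    (ltW ra).
  have Y0 := Y_ge0 hh fa; have XYM := XY_lt hh fa.
  apply/ltW/g_lt1.
  + by rewrite fa mesh_floor_ge0.
  + by apply: le_trans (ltW XYM); rewrite lerDl.
  + by rewrite Y0 (le_trans _ (ltW XYM))// lerDr.
Qed.

Lemma limit_tau_increment_le a b : 0 <= a -> a <= b -> b <= alpha ->
  tau b - tau a <= b - a.
Proof.
move=> a0 ab ba; apply/ler_addgt0Pr => e e0.
have e20 : 0 < e / 2 by rewrite divr_gt0.
have [h [hh [_ h1] [_ h2]]] := approximation2 e20 (le_trans ab ba) ba.
have := Y_increment_le hh a0 ab ba.
move: h1 h2; rewrite !ltr_norml => /andP[h1 h2] /andP[h3 h4] h5.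
by move: h1 h2 h3 h4 h5; clear_local; lra.
Qed.

Lemma limit_tau_continuous : {within `[0, alpha], continuous tau}.
Proof.
apply/subspace_continuousP => s; rewrite /= in_itv/= => s0a.
apply/cvgrPdist_lt => e e0; apply/within_ex.
have c0 : 0 < 1 + M3 by rewrite ltr_wpDr.
exists (e / (1 + M3)); first by rewrite divr_gt0.
move=> r; rewrite /= in_itv/= => r0a; rewrite ltr_pdivlMr// mulrDr mulr1 => rs.
rewrite distrC; apply: le_lt_trans (limit_tau_lip r0a s0a) _.
by rewrite mulrC; apply: le_lt_trans rs; rewrite lerDr.
Qed.

(** * Schemes near a time that is not an impulse *)

Lemma nonimpulse_nbhs s : 0 <= s <= alpha -> ~ impulse_times K t s ->
  exists2 k : int, k <= K%:Z & impulse_itv T K t k s /\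
  exists2 e, 0 < e & forall r, 0 <= r <= alpha -> `|r - s| < e ->
    impulse_itv T K t k r.
Proof.
move=> /andP[s0 sa] ns; have sT : s <= T by exact: le_trans sa _.
have [k kK [ks /(_ s0) k0]] := impulse_itv_cover ht sT.
exists k => //; split => //.
(* A left knot that is not an impulse time must be [t 0 = 0]; there a right neighbourhood suffices,
   only [r >= 0] being considered. *)
have [skE|sk] := eqVneq s (t k); last first.
  have [e e0 eP] := impulse_itv_near ht kK ks sk.
  by exists e => // r /andP[_ ra]; apply: eP; exact: le_trans ra _.
have k00 : k = 0.
  case: k k0 kK {ks} skE => // k _ kK skE; case: (posnP k) => [->//|k1].
  by exfalso; apply: ns; exists k => //; rewrite k1.
have sE : s = 0 by rewrite skE k00; case: ht.
have [|e e0 eP] := impulse_itv_right ht kK ks.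
  by rewrite sE (lt_le_trans alpha_gt0).
exists e => // r /andP[r0 _]; rewrite sE subr0 ger0_norm// => re.
by apply: eP; rewrite sE r0 add0r.
Qed.

(** Closeness of a scheme to the limit at the single time [s] spreads to the mesh points near [s],
    with [d] independent of [h], because the Lipschitz constants are common to all schemes. *)
Lemma state_close s e : 0 <= s <= alpha -> ~ impulse_times K t s -> 0 < e ->
  exists2 d, 0 < d & forall h r, 0 < h < hstar -> h < d -> 0 <= r <= alpha ->
    `|r - s| < d -> N (X h s - x s) < d -> `|Y h s - tau s| < d ->
    [/\ 0 <= mesh_floor h r <= alpha, `|mesh_floor h r - s| < e,
      N (X h (mesh_floor h r) - x s) < e & `|Y h (mesh_floor h r) - tau s| < e].
Proof.
move=> s0a ns e0; have /andP[s0 sa] := s0a.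
have [k kK [ks [e1 e10 e1P]]] := nonimpulse_nbhs s0a ns.
have c0 : 0 < 3 + 2 * M2 + 2 * M3 by rewrite ltr_wpDr ?mulr_ge0// ltr_wpDr
  ?mulr_ge0.
(* The mesh point is within [2 * d] of [s]: one [d] for [r], one for the mesh size. The schemes vary
   by at most [M2 * (2 * d)] and [M3 * (2 * d)] over this distance, to which the error at [s] is
   added. *)
pose d := Num.min (e1 / 2) (e / (3 + 2 * M2 + 2 * M3)).
have d0 : 0 < d by rewrite lt_min !divr_gt0.
have de1 : d <= e1 / 2 by rewrite ge_min lexx.
have dc : (3 + 2 * M2 + 2 * M3) * d <= e.
  by rewrite -ler_pdivlMl// mulrC ge_min lexx orbT.
have M2d : 0 <= M2 * d by rewrite mulr_ge0// ltW.
have M3d : 0 <= M3 * d by rewrite mulr_ge0// ltW.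
exists d => // h r hh hd /andP[r0 ra] rsd Xs Ys; have /andP[h0 _] := hh.
have fa : 0 <= mesh_floor h r <= alpha.
  by rewrite mesh_floor_ge0// (le_trans (mesh_floor_le r h0)).
have fs : `|mesh_floor h r - s| < 2 * d.
  have := mesh_floor_le r h0; have := mesh_floor_gt r h0.
  move: hd rsd; rewrite !ltr_norml => hd /andP[r1 r2] h1 h2.
  by move: hd r1 r2 h1 h2; clear_local => *; apply/andP; split; lra.
have sa' : 0 <= s <= alpha by rewrite s0.
have M1h := M1_ge0 hh.
have XX : N (X h (mesh_floor h r) - X h s) <= M2 * (2 * d).
  apply: le_trans (X_lip hh kK _ ks _ _) _.
  - by apply: e1P => //; move: fs de1; clear_local; lra.
  - by case/andP: fa => fa1 ->; rewrite (le_trans _ fa1)// oppr_le0.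
  - by rewrite sa (le_trans _ s0)// oppr_le0.
  - by rewrite ler_wpM2l// ltW.
have YY : `|Y h (mesh_floor h r) - Y h s| <= M3 * (2 * d).
  by apply: le_trans (Y_lip hh fa sa') _; rewrite ler_wpM2l// ltW.
split => //.
- by move: fs dc M2d M3d d0; clear_local; lra.
- have := is_norm_distD hN (X h s) (X h (mesh_floor h r)) (x s).
  by move: XX Xs dc M2d M3d d0; clear_local; lra.
- have := ler_distD (Y h s) (Y h (mesh_floor h r)) (tau s).
  by move: YY Ys dc M2d M3d d0; clear_local; lra.
Qed.

(** Since [s - tau s] is no knot, a full neighbourhood of it lies in one interval between knots, on
    which the schemes share a Lipschitz constant. As [s > 0], it also lies strictly above [- M1],
    inside the range of those bounds. *)
Lemma delayed_close s e : 0 < s < alpha -> ~ impulse_times K t s ->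
  (forall k : int, k <= K%:Z -> s - tau s != t k) -> 0 < e ->
  exists2 d, 0 < d & forall h r, 0 < h < hstar -> h < d -> 0 <= r <= alpha ->
    `|r - s| < d -> N (X h s - x s) < d -> `|Y h s - tau s| < d ->
    N (X h (s - tau s) - x (s - tau s)) < d ->
    N (X h (mesh_delayed h (Y h) r) - x (s - tau s)) < e.
Proof.
move=> /andP[s0 sa] ns nk e0; set p := s - tau s.
have t0 := limit_tau_ge0 (ltW sa).
have pa : p < alpha by move: t0 sa; rewrite /p; clear_local; lra.
have pM1 : - M1 < p.
  have := limit_bound (ltW sa); have := N0 (x s); rewrite /p.
  by move: s0; clear_local; lra.
have pT : p <= T by exact: le_trans (ltW pa) _.
have [k kK [kp _]] := impulse_itv_cover ht pT.
have [e1 e10 e1P] := impulse_itv_near ht kK kp (nk k kK).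
have M21 : 0 < 1 + M2 by rewrite ltr_wpDr.
pose rho := Num.min (Num.min e1 (alpha - p)) (Num.min (p + M1) (e / (1 + M2))).
have rho0 : 0 < rho.
  by rewrite !lt_min e10 subr_gt0 pa divr_gt0//= andbT -ltrBlDr sub0r.
have : rho <= rho by [].
rewrite {2}/rho !le_min => /andP[/andP[rho1 rho2] /andP[rho3 rho4]].
have sa' : 0 <= s <= alpha by rewrite !ltW.
(* Three errors add up in the delayed argument: the mesh point against [s], the discrete delay
   against [tau s], and the rounding of that delay. *)
have rho40 : 0 < rho / 4 by rewrite divr_gt0.
have [d1 d10 d1P] := state_close sa' ns rho40.
exists (Num.min d1 (rho / 4)); first by rewrite lt_min d10.
move=> h r hh; rewrite !lt_min => /andP[h1 h2] r0 /andP[r1 r2] /andP[X1 X2].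
move=> /andP[Y1 Y2] /andP[Xp1 Xp2]; have /andP[h0 _] := hh.
have [fa fs Xf Yf] := d1P h r hh h1 r0 r1 X1 Y1.
set q := mesh_delayed h (Y h) r.
have qp : `|q - p| < rho.
  have := mesh_floor_le (Y h (mesh_floor h r)) h0.
  have := mesh_floor_gt (Y h (mesh_floor h r)) h0.
  rewrite /q /mesh_delayed /p; move: fs Yf h2 rho0.
  rewrite !ltr_norml; clear_local => /andP[? ?] /andP[? ?] ? ? ? ?.
  by apply/andP; split; lra.
have qpl : q - p < rho /\ - rho < q - p by move: qp;
  rewrite ltr_norml => /andP[].
have qa : q <= alpha by case: qpl; move: rho2; clear_local; lra.
have XX : N (X h q - X h p) <= M2 * `|q - p|.
  apply: (X_lip hh kK) => //.
  - by apply: e1P; [exact: le_trans qa _|exact: lt_le_trans rho1].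
  - by rewrite qa andbT; case: qpl; move: rho3; clear_local; lra.
  - by rewrite !ltW.
have M2q : M2 * `|q - p| <= M2 * rho by rewrite ler_wpM2l// ltW.
have rhoe : (1 + M2) * rho <= e by rewrite -ler_pdivlMl// mulrC.
have := is_norm_distD hN (X h p) (X h q) (x p).
by move: XX M2q rhoe Xp2 rho0; clear_local; lra.
Qed.

(** * The differential equations for the limit *)

Lemma limit_tau_expansion s : 0 <= s <= alpha -> ~ impulse_times K t s ->
  @expansion_within R R^o `[0, alpha] tau s (g s (x s) (tau s)).
Proof.
move=> s0a ns e e0; have /andP[s0 sa] := s0a.
have sT : 0 <= s <= T by rewrite s0 (le_trans sa).
have [d1 d10 d1P] := hyp_g_cont hN (x s) (tau s) hg sT e0.
have [d d0 dP] := state_close s0a ns d10.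
exists d => // r; rewrite /= in_itv/= => r0a rsd; have /andP[r0 ra] := r0a.
(* The slack [c] is introduced after [r]: as [d] does not depend on the mesh, a scheme within
   [c / 2] of the limit at both [s] and [r] can be chosen for each [r] separately. *)
apply/ler_addgt0Pr => c c0; have c20 : 0 < c / 2 by rewrite divr_gt0.
have [|||h [hd hh hP]] := @approximation [:: s; r] d (Num.min d (c / 2)) => //.
- by rewrite lt_min d0.
- by move=> q; rewrite !inE => /orP[] /eqP ->.
have [] := hP s (mem_head _ _); rewrite !lt_min => /andP[X1 X2] /andP[Y1 Y2].
have [] := hP r; first by rewrite !inE eqxx orbT.
move=> _; rewrite lt_min => /andP[_ Y3].
have incr a b : a <= b -> 0 <= a -> b <= alpha ->
    (forall q, a <= q <= b -> `|q - s| <= `|r - s|) ->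
    `|Y h b - Y h a - (b - a) * g s (x s) (tau s)| <= e * (b - a).
  move=> ab a0 ba abs; apply: Y_increment => //; first exact: ltW.
  move=> q /andP[aq qb].
  have q0 : 0 <= q <= alpha by rewrite (le_trans a0 aq) (le_trans (ltW qb)).
  have qs : `|q - s| < d.
    by apply: le_lt_trans rsd; apply: abs; rewrite aq ltW.
  have [fa fs Xf Yf] := dP h q hh hd q0 qs X1 Y1.
  apply/ltW/d1P => //; case/andP: fa => -> /le_trans; exact.
have : `|Y h r - Y h s - (r - s) * g s (x s) (tau s)| <= e * `|r - s|.
  have [sr|/ltW rs] := leP s r.
    rewrite (ger0_norm (_ : 0 <= r - s)) ?subr_ge0//; apply: incr => //.
    by move=> q /andP[sq qr]; rewrite !ger0_norm ?subr_ge0// lerD2r.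
  have -> : Y h r - Y h s - (r - s) * g s (x s) (tau s) =
    - (Y h s - Y h r - (s - r) * g s (x s) (tau s)) by ring.
  rewrite normrN.
  rewrite (ler0_norm (_ : r - s <= 0)) ?subr_le0// opprB; apply: incr => //.
  by move=> q /andP[rq qs]; rewrite !ler0_norm ?subr_le0// !opprB lerD2l lerN2.
change (`|Y h r - Y h s - (r - s) * g s (x s) (tau s)| <= e * `|r - s| ->
  `|tau r - tau s - (r - s) * g s (x s) (tau s)| <= e * `|r - s| + c).
have -> : tau r - tau s - (r - s) * g s (x s) (tau s) =
  (Y h r - Y h s - (r - s) * g s (x s) (tau s))
    - ((Y h r - tau r) - (Y h s - tau s)) by ring.
move: Y2 Y3; set u := Y h s - tau s; set v := Y h r - tau r;
  set w := _ - _ - _ * _.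
have := ler_normB w (v - u); have := ler_normB v u.
by clear_local; lra.
Qed.

Lemma limit_x_expansion s : 0 < s < alpha -> ~ impulse_times K t s ->
  (forall k : int, k <= K%:Z -> s - tau s != t k) ->
  expansion_within setT x s (f s (x s) (x (s - tau s))).
Proof.
move=> s0a ns nk e e0; have /andP[s0 sa] := s0a; set p := s - tau s.
have s0a' : 0 <= s <= alpha by rewrite !ltW.
have sT : 0 <= s <= T by rewrite ltW// (le_trans (ltW sa)).
have pa : p <= alpha.
  by have := limit_tau_ge0 (ltW sa); move: sa; rewrite /p; clear_local; lra.
have [C C0 NC] := is_norm_le_mx_norm hN.
have [c c0 cN] := mx_norm_le_is_norm hN.
have ec0 : 0 < e / c by rewrite divr_gt0.
have [d1 d10 d1P] := hyp_f_cont hN (x s) (x p) hf sT ec0.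
have [d2 d20 d2P] := state_close s0a' ns d10.
have [d3 d30 d3P] := delayed_close s0a ns nk d10.
have [k' kK [ks /(_ (ltW s0)) k0]] := impulse_itv_cover ht (le_trans (ltW sa)
  alpha_leT).
case: k' kK ks k0 => // k kK ks _; have kK' : (k <= K)%N by exact: kK.
have sk : s != t k%:Z.
  apply/eqP => sE; case: (posnP k) => [k0|k1]; last first.
    by apply: ns; exists k => //; rewrite k1.
  by move: s0; rewrite sE k0; case: ht => -> _ _ _; rewrite ltxx.
have [d4 d40 d4P] := impulse_itv_near ht kK ks sk.
pose d := Num.min (Num.min d2 d3) (Num.min d4 (Num.min s (alpha - s))).
have d0 : 0 < d by rewrite !lt_min d20 d30 d40 s0 subr_gt0.
have : d <= d by [].
rewrite {2}/d !le_min => /andP[/andP[dd2 dd3] /and3P[dd4 dds dda]].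
clearbody d; exists d => // r _ rsd.
have r0a : 0 <= r <= alpha.
  move: rsd dds dda; rewrite ltr_norml; clear_local => /andP[? ?] ? ?.
  by apply/andP; split; lra.
have /andP[r0 ra] := r0a.
have kr : impulse_itv T K t k r.
  by apply: d4P; [exact: le_trans ra _|exact: lt_le_trans dd4].
(* The errors at [s] and [r] take half of the slack each, and [c] converts [N] into the matrix norm.
   The delayed time [p] joins the list of approximated times. *)
apply/ler_addgt0Pr => y y0; have yc : 0 < y / c / 2 by rewrite !divr_gt0.
have [|||h [hd hh hP]] := @approximation [:: s; r;
  p] d (Num.min d (y / c / 2)) => //.
- by rewrite lt_min d0.
- by move=> q; rewrite !inE => /or3P[] /eqP -> //; exact: ltW.
have [] := hP s (mem_head _ _); rewrite !lt_min => /andP[X1 X2] /andP[Y1 _].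
have [] := hP r; first by rewrite !inE eqxx orbT.
rewrite lt_min => /andP[_ X3] _.
have [] := hP p; first by rewrite !inE eqxx !orbT.
rewrite lt_min => /andP[X4 _] _.
have incr a b : a <= b -> impulse_itv T K t k a -> impulse_itv T K t k b ->
    0 <= a -> b <= alpha ->
    (forall q, a <= q <= b -> `|q - s| <= `|r - s|) ->
    N (X h b - X h a - (b - a) *: f s (x s) (x p)) <= e / c * (b - a).
  move=> ab ka kb a0 ba abs; apply: (X_increment hh kK') => //;
    first exact: ltW.
  move=> q /andP[aq qb].
  have q0 : 0 <= q <= alpha by rewrite (le_trans a0 aq) (le_trans (ltW qb)).
  have qs : `|q - s| < d.
    by apply: le_lt_trans rsd; apply: abs; rewrite aq ltW.
  have [fa fs Xf Yf] := d2P h q hh (lt_le_trans hd dd2) q0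
    (lt_le_trans qs dd2) (lt_le_trans X1 dd2) (lt_le_trans Y1 dd2).
  have Xq := d3P h q hh (lt_le_trans hd dd3) q0
    (lt_le_trans qs dd3) (lt_le_trans X1 dd3) (lt_le_trans Y1 dd3)
    (lt_le_trans X4 dd3).
  apply/ltW/d1P => //; case/andP: fa => -> /le_trans; exact.
have Xrs : N (X h r - X h s - (r - s) *: f s (x s) (x p)) <= e / c * `|r - s|.
  have [sr|/ltW rs] := leP s r.
    rewrite (ger0_norm (_ : 0 <= r - s)) ?subr_ge0//; apply: incr => //.
      exact: ltW.
    by move=> q /andP[sq qr]; rewrite !ger0_norm ?subr_ge0// lerD2r.
  have -> : X h r - X h s - (r - s) *: f s (x s) (x p) =
    - (X h s - X h r - (s - r) *: f s (x s) (x p)).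
    by rewrite !opprB -[s - r]opprB scaleNr addrC.
  rewrite (is_normN hN) (ler0_norm (_ : r - s <= 0)) ?subr_le0// opprB.
  apply: incr => //; first exact: ltW.
  by move=> q /andP[rq qs]; rewrite !ler0_norm ?subr_le0// !opprB lerD2l lerN2.
apply: le_trans (cN _) _.
have -> : x r - x s - (r - s) *: f s (x s) (x p) =
    (X h r - X h s - (r - s) *: f s (x s) (x p))
    - ((X h r - x r) - (X h s - x s)).
  rewrite (subrACA (X h r) (x r)); set u := X h r - X h s; set v := x r - x s.
  by rewrite opprB [RHS]addrC [RHS]addrA subrK.
have := is_normB hN (X h r - X h s - (r - s) *: f s (x s) (x p))
  ((X h r - x r) - (X h s - x s)).
have := is_normB hN (X h r - x r) (X h s - x s).
set u := N (_ - _ - _); set v := N (_ - _ - _ *: _) in Xrs *;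
  set w := N (_ - _ - _ - _).
move=> h1 h2.
have : c * w <= c * (e / c * `|r - s| + y / c).
  rewrite ler_pM2l//.
  have : y / c = y / c / 2 + y / c / 2 by field; rewrite gt_eqF.
  by move: X2 X3 h1 h2 Xrs; clear_local; lra.
rewrite mulrDr mulrA mulrCA !mulfV ?gt_eqF// !mulr1 mulrCA.
by rewrite mulfV ?gt_eqF// mulr1.
Qed.

(** * Strict growth of the delayed argument *)

Lemma limit_g_lt1 s : 0 <= s <= alpha -> g s (x s) (tau s) < 1.
Proof.
move=> s0a; have /andP[_ sa] := s0a; have t0 := limit_tau_ge0 sa.
have xM := limit_bound sa; have xs0 := N0 (x s).
by apply: g_lt1 => //; move: t0 xM xs0; clear_local => *; [|apply/andP;
  split]; lra.
Qed.

(** The schemes yield only the weak inequality in the limit. Failure of strictness would force [tau]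
    to have slope exactly 1 on all of [[a, b]], whereas at an inner time that is no impulse its
    derivative is a value of [g] below 1. *)
Lemma limit_delay_strict a b : 0 <= a -> a < b -> b <= alpha ->
  a - tau a < b - tau b.
Proof.
move=> a0 ab ba; rewrite ltNge; apply/negP => hab.
have tauE r : a <= r <= b -> tau r - tau a = r - a.
  move=> /andP[ar rb].
  have := limit_tau_increment_le a0 ar (le_trans rb ba).
  have := limit_tau_increment_le (le_trans a0 ar) rb ba.
  by move: hab; clear_local => *; apply/eqP; rewrite eq_le; apply/andP; split;
    lra.
have aT : a < T by exact: lt_le_trans (lt_le_trans ab ba) _.
have [k kK [ka _]] := impulse_itv_cover ht (ltW aT).
have [e e0 eP] := impulse_itv_right ht kK ka aT.
pose r := a + Num.min (b - a) e / 2.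
have m0 : 0 < Num.min (b - a) e by rewrite lt_min subr_gt0 ab.
have mb : Num.min (b - a) e <= b - a by rewrite ge_min lexx.
have me : Num.min (b - a) e <= e by rewrite ge_min lexx orbT.
have ar : a < r by rewrite ltrDl divr_gt0.
have rb : r < b by move: m0 mb; rewrite /r; clear_local; lra.
have re : r < a + e by move: m0 me; rewrite /r; clear_local; lra.
have kr : impulse_itv T K t k r by apply: eP; rewrite ltW.
have nr : ~ impulse_times K t r.
  apply: (impulse_itv_not_impulse ht kK kr); move/(impulse_itvE ht _ kK) : ka.
  by case=> ta _ _; exact: le_lt_trans ar.
have r0a : 0 <= r <= alpha by rewrite (le_trans a0 (ltW ar)) (le_trans (ltW
  rb)).
have g1 := limit_g_lt1 r0a.
have e'0 : 0 < (1 - g r (x r) (tau r)) / 2 by rewrite divr_gt0 ?subr_gt0.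
have [d d0 dP] := limit_tau_expansion r0a nr e'0.
pose q := r + Num.min (b - r) d / 2.
have m'0 : 0 < Num.min (b - r) d by rewrite lt_min subr_gt0 rb.
have m'b : Num.min (b - r) d <= b - r by rewrite ge_min lexx.
have m'd : Num.min (b - r) d <= d by rewrite ge_min lexx orbT.
have rq : r < q by rewrite ltrDl divr_gt0.
have qb : q <= b by move: m'0 m'b; rewrite /q; clear_local; lra.
have qd : q - r < d by move: m'0 m'd; rewrite /q; clear_local; lra.
have := dP q; rewrite /= in_itv/= (le_trans _ ba)// andbT gtr0_norm ?subr_gt0//.
have q0 : 0 <= q by rewrite (le_trans _ (ltW rq))//; case/andP: r0a.
move=> /(_ q0 qd).
have tr : tau r - tau a = r - a by apply: tauE; rewrite !ltW.
have tq : tau q - tau a = q - a.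
  by apply: tauE; rewrite qb andbT (le_trans (ltW ar))// ltW.
have -> : tau q - tau r = q - r by move: tr tq; clear_local; lra.
set c := g r (x r) (tau r) in g1 *.
have w0 : 0 < (1 - c) * (q - r) by rewrite mulr_gt0 ?subr_gt0.
have -> : `|q - r - (q - r) *: (c : R^o)| = (1 - c) * (q - r).
  by rewrite -(gtr0_norm w0) [_ *: _]/(_ * _) mulrBl mul1r mulrC.
rewrite [leRHS]mulrAC leNgt => /negP; apply.
by rewrite ltr_pdivrMr// ltr_pMr// ltr1n.
Qed.

Lemma limit_ae_regular : {ae lebesgue_measure, forall s, 0 <= s <= alpha ->
  [/\ 0 < s < alpha, ~ impulse_times K t s &
    forall k : int, k <= K%:Z -> s - tau s != t k]}.
Proof.
(* By strict growth each knot is the delayed argument of at most one time, so this is a countable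
   union of finite sets. The endpoints are added because two-sided derivatives are obtained only
   inside [[0, alpha]]. *)
pose A : set R := \bigcup_(k : int) ([set 0; alpha] `|` [set t k] `|`
  [set s | 0 <= s <= alpha /\ s - tau s = t k]).
have cA : countable A.
  apply: bigcup_countable => // k _; apply: finite_set_countable.
  rewrite !finite_setU; split; first by split; [split|]; exact: finite_set1.
  have [[r [r0 rk]]|nr] := pselect (exists r, 0 <= r <= alpha /\ r - tau r = t
    k).
    apply: (@sub_finite_set _ _ [set r]); last exact: finite_set1.
    move=> s [/= s0 sk]; have /andP[s0' sa] := s0; have /andP[r0' ra] := r0.
    case: (ltgtP s r) => // sr.
      by have := limit_delay_strict s0' sr ra; rewrite sk rk ltxx.
    by have := limit_delay_strict r0' sr sa; rewrite sk rk ltxx.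
  by rewrite (_ : mkset _ = set0)//; apply/seteqP; split => // s hs;
    apply: nr; exists s.
exists A; split.
- exact: countable_measurable.
- exact: countable_lebesgue_measure0.
move=> s /= ns; apply: contrapT => nA; apply: ns => s0a; split.
- have /andP[s0 sa] := s0a; rewrite !lt_neqAle s0 sa !andbT.
  by apply/andP; split; apply/eqP => sE; apply: nA; exists 0 => //; left; left;
    rewrite /= -?sE ?sE; [left|right].
- by move=> [k _ sE]; apply: nA; exists k%:Z => //; left; right.
- by move=> k _; apply/eqP => sk; apply: nA; exists k => //; right.
Qed.

(** * Positivity of the delay and jump relations *)

Lemma left_nbhs s : 0 < s <= alpha -> exists (k : nat) (a : R),
  [/\ (k <= K)%N, 0 <= a, a < s & forall r, a <= r < s ->
    impulse_itv T K t k%:Z r].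
Proof.
move=> /andP[s0 sa]; have sT : s <= T by exact: le_trans sa _.
have [k' kK [ks /(_ (ltW s0)) k0]] := impulse_itv_cover ht sT.
case: k' kK ks k0 => // k kK ks _; have kK' : (k <= K)%N by exact: kK.
have [sE|sk] := eqVneq s (t k%:Z).
  case: k kK ks kK' sE => [|k] kK ks kK' sE.
    by move: s0; rewrite sE; case: ht => -> _ _ _; rewrite ltxx.
  exists k, (t k%:Z); split.
  - exact: ltnW.
  - by have [<- _ _ _] := ht; apply: (knot_le ht); lia.
  - by rewrite sE; apply: (knot_lt ht); lia.
  - move=> r /andP[kr rs]; apply: (impulse_itv_before (t := t)); first lia.
    by rewrite kr (_ : k%:Z + 1 = k.+1%:Z) -?sE//; lia.
have [e e0 eP] := impulse_itv_left ht kK ks sk.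
exists k, (Num.max 0 (s - e / 2)); split => //.
- by rewrite le_max lexx.
- by rewrite gt_max s0/= ltrBlDr ltrDl divr_gt0.
- move=> r /andP[+ rs]; rewrite ge_max => /andP[_ re]; apply: eP.
  by rewrite (ltW rs) andbT (lt_le_trans _ re)// ltrD2l ltrN2 ltr_pdivrMr//
    ltr_pMr// ltr1n.
Qed.

(** A first step gives [0 <= tau]. At a zero [s] of [tau], necessarily positive as [tau 0 = lambda],
    hypothesis (2) makes [g] positive just before [s], so [tau] would be negative there. Since [x]
    may jump at [s], its left limit [l] is used. *)
Lemma limit_tau_gt0 s : 0 <= s <= alpha -> 0 < tau s.
Proof.
move=> s0a; have /andP[s0 sa] := s0a.
rewrite lt_neqAle (limit_tau_ge0 sa) andbT; apply/eqP => /esym ts0.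
have s_gt0 : 0 < s.
  rewrite lt_neqAle s0 andbT; apply/eqP => sE.
  by move: lambda_gt0; rewrite -(limit_tau_init (lexx 0)) {2}sE ts0 ltxx.
have [|k [a [kK a0 as_ kP]]] := @left_nbhs s; first by rewrite s_gt0.
have kKz : k%:Z <= K%:Z by [].
have M10 : 0 <= M1.
  by have := limit_bound sa; rewrite ts0 addr0; exact: le_trans (N0 _).
have dom r : a <= r < s -> - M1 <= r <= alpha.
  move=> /andP[ar rs]; rewrite (le_trans (ltW rs) sa) andbT.
  by rewrite (le_trans _ (le_trans a0 ar))// oppr_le0.
have [|l _ xl] := lipschitz_left_cvg hN as_ M2_ge0 (F := x).
  by move=> r r' ar ar'; apply: (limit_x_lip kKz);
    [exact: kP|exact: kP|exact: dom|exact: dom].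
have sT : 0 <= s <= T by rewrite s0 (le_trans sa).
have [_ g0 _] := hg; have gs0 := g0 s l sT.
have [d d0 dP] := hyp_g_cont hN l 0 hg sT gs0.
have c0 : 0 < 1 + M2 + M3 by rewrite ltr_wpDr// ltr_wpDr.
(* From [b] on, the time, the state and the delay all stay within [d] of [s], [l] and 0. *)
pose b := Num.max a (s - d / (1 + M2 + M3) / 2).
have ab : a <= b by rewrite le_max lexx.
have dc : 0 < d / (1 + M2 + M3) by rewrite divr_gt0.
have bs : b < s by rewrite gt_max as_/= ltrBlDr ltrDl divr_gt0.
have b0 : 0 <= b by exact: le_trans ab.
have gpos r : b <= r < s -> 0 < g r (x r) (tau r).
  move=> /andP[br rs]; have r0 : 0 <= r by exact: le_trans br.
  have ra : r <= alpha by exact: le_trans (ltW rs) sa.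
  have rd : (1 + M2 + M3) * (s - r) < d.
    rewrite mulrC -ltr_pdivlMr//; move: br; rewrite ge_max => /andP[_].
    by move: dc; clear_local; lra.
  have sr : 0 < s - r by rewrite subr_gt0.
  have M2r : 0 <= M2 * (s - r) by rewrite mulr_ge0// ltW.
  have M3r : 0 <= M3 * (s - r) by rewrite mulr_ge0// ltW.
  have : `|g r (x r) (tau r) - g s l 0| < g s l 0.
    apply: dP; first by rewrite r0 (le_trans ra).
    - by rewrite distrC gtr0_norm//; move: rd M2r M3r; clear_local; lra.
    - apply: le_lt_trans (xl r _) _; first by rewrite (le_trans ab br).
      by move: rd M2r M3r sr; clear_local; lra.
    - rewrite -ts0 distrC; apply: le_lt_trans (limit_tau_lip s0a _) _.
        by rewrite r0.
      by rewrite gtr0_norm//; move: rd M2r M3r sr; clear_local; lra.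
  by rewrite ltr_norml => /andP[+ _]; clear_local; lra.
have isd r : r \in `]b, s[%R -> is_derive r 1 tau (g r (x r) (tau r)).
  rewrite in_itv/= => /andP[br rs]; apply/is_deriveP.
  have r0 : 0 < r by exact: le_lt_trans br.
  have ra : r < alpha by exact: lt_le_trans sa.
  have nr : ~ impulse_times K t r.
    apply: (impulse_itv_not_impulse ht kKz).
      by apply: kP; rewrite rs (le_trans ab (ltW br)).
    have : impulse_itv T K t k%:Z a by apply: kP; rewrite lexx.
    move=> /(impulse_itvE ht _ kKz)[ka _ _].
    by apply: le_lt_trans ka _; exact: le_lt_trans br.
  apply: (@expansion_interior R R^o tau 0 alpha); last by rewrite r0.
  by apply: limit_tau_expansion => //; rewrite !ltW.
have ct : {within `[b, s], continuous tau}.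
  apply: continuous_subspaceW limit_tau_continuous => r.
  by rewrite /= !in_itv/= => /andP[br rs];
    rewrite (le_trans b0)// (le_trans rs).
have [c] := MVT bs isd ct.
rewrite in_itv/= ts0 sub0r => /andP[bc cs] tb.
have tb0 : 0 <= tau b by apply: limit_tau_ge0; exact: le_trans (ltW bs) sa.
have : 0 < g c (x c) (tau c) * (s - b).
  by rewrite mulr_gt0 ?subr_gt0// gpos// ltW.
by rewrite -tb oppr_gt0 ltNge tb0.
Qed.

(** The left limits of scheme and limit are compared through one time [s] shortly before the
    impulse, where the common rate bounds both distances; Lipschitz continuity of the impulse map
    then transfers the jump relation. *)
Lemma limit_impulse (k : nat) : (1 <= k <= K)%N -> t k%:Z <= alpha ->
  impulse_at x (t k%:Z) (I k).
Proof.
case: k => // k /andP[_ kK] ka; set v := t k.+1%:Z; pose a := t k%:Z.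
have av : a < v by apply: (knot_lt ht); lia.
have a0 : 0 <= a by have [<- _ _ _] := ht; apply: (knot_le ht); lia.
have kKz : k%:Z <= K%:Z by lia.
have kP r : a <= r < v -> impulse_itv T K t k%:Z r.
  move=> arv; apply: (impulse_itv_before (t := t)); first lia.
  by rewrite (_ : k%:Z + 1 = k.+1%:Z)//; lia.
have M10 : 0 <= M1.
  by have := limit_bound ka; have := limit_tau_ge0 ka; have := N0 (x v);
    rewrite /v; clear_local; lra.
have dom r : a <= r < v -> - M1 <= r <= alpha.
  move=> /andP[ar rs]; rewrite (le_trans (ltW rs) ka) andbT.
  by rewrite (le_trans _ (le_trans a0 ar))// oppr_le0.
have [|l xcvg xl] := lipschitz_left_cvg hN av M2_ge0 (F := x).
  by move=> r r' ar ar'; apply: (limit_x_lip kKz);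
    [exact: kP|exact: kP|exact: dom|exact: dom].
have lE : lim (x @ v^'-) = l by exact: cvg_lim.
split; first by apply/cvg_ex; exists l.
rewrite lE; apply/eqP; rewrite -subr_eq0; apply/eqP; case: (hN) => _ _; apply.
apply/eqP; rewrite eq_le N0 andbT; apply/ler_addgt0Pr => e e0; rewrite add0r.
have [L3 L30 IL] := hI.
have c0 : 0 < 4 + 3 * L3 by rewrite ltr_wpDr// mulr_ge0.
(* The value at the impulse contributes [y], the left limits [3 * y], and the impulse map
   [L3 * (3 * y)]. *)
pose y := e / (4 + 3 * L3); have y0 : 0 < y by rewrite divr_gt0.
have M21 : 0 < 1 + M2 by rewrite ltr_wpDr.
have y2 : 0 < y / (1 + M2) by rewrite divr_gt0.
pose s := Num.max a (v - y / (1 + M2)).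
have sv : s < v by rewrite gt_max av/= ltrBlDr ltrDl.
have as_ : a <= s by rewrite le_max lexx.
have vs : M2 * (v - s) <= y.
  apply: (@le_trans _ _ ((1 + M2) * (v - s))).
    by rewrite ler_wpM2r ?subr_ge0 ?(ltW sv)// lerDr.
  by rewrite mulrC -ler_pdivlMr// lerBlDr -lerBlDl le_max lexx orbT.
have [h [hh [h1 _] [h2 _]]] := approximation2 y0 (le_trans (ltW sv) ka) ka.
have [|lh Xcvg Xl] := lipschitz_left_cvg hN av M2_ge0 (F := X h).
  by move=> r r' ar ar'; apply: (X_lip hh kKz);
    [exact: kP|exact: kP|exact: dom|exact: dom].
have [_] := sch_impulse (XY_scheme hh) (k := k.+1) kK ka.
have -> : lim (X h @ v^'-) = lh by exact: cvg_lim.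
move=> Xv; have asv : a <= s < v by rewrite as_.
have llh : N (lh - l) <= 3 * y.
  have := Xl s asv; have := xl s asv; rewrite (is_norm_distC hN (X h s) lh).
  have := is_norm_distD hN (X h s) lh l;
    have := is_norm_distD hN (x s) (X h s) l.
  by move: h1 vs; clear_local; lra.
have Ill : N (I k.+1 lh - I k.+1 l) <= L3 * (3 * y).
  by apply: le_trans (IL _ _ _ _) _ => //; rewrite ler_wpM2l.
have -> : x v - l - I k.+1 l =
    (x v - X h v) + ((lh - l) + (I k.+1 lh - I k.+1 l)).
  rewrite -[I k.+1 lh]Xv; set p := x v; set q := X h v; set r := I _ _.
  have E1 : lh - l + (q - lh - r) = q - l - r.
    by rewrite addrA [_ + (q - lh)]addrC addrA subrK.
  by rewrite E1 !addrA subrK.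
have := is_normD hN (x v - X h v) ((lh - l) + (I k.+1 lh - I k.+1 l)).
have := is_normD hN (lh - l) (I k.+1 lh - I k.+1 l).
have yE : y * 4 + 3 * (L3 * y) = e by rewrite /y; field; rewrite gt_eqF.
move: h2; rewrite (is_norm_distC hN) => h2.
by move: h2 llh Ill yE; clear_local; lra.
Qed.

Lemma limit_solution : solution N T K t f g I phi lambda alpha x tau.
Proof.
have dom k r : k <= K%:Z -> (impulse_itv T K t k `&` `[0, alpha]) r ->
    - M1 <= r <= alpha.
  move=> kK [_]; rewrite /= in_itv/= => /andP[r0 ra]; rewrite ra andbT.
  have := limit_bound ra; have := limit_tau_ge0 ra; have := N0 (x r).
  by move: r0; clear_local; lra.
split.
- move=> k kK; apply: (@abs_cont_lip _ _ N _ x M2 M2_ge0) => s s' ss' sub.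
  have hs : (impulse_itv T K t k%:Z `&` `[0, alpha]) s.
    by apply: sub; rewrite /= in_itv/= lexx.
  have hs' : (impulse_itv T K t k%:Z `&` `[0, alpha]) s'.
    by apply: sub; rewrite /= in_itv/= lexx ss'.
  rewrite -[s' - s]ger0_norm ?subr_ge0//; apply: (@limit_x_lip k%:Z) => //.
  + by case: hs'.
  + by case: hs.
  + exact: (dom k%:Z).
  + exact: (dom k%:Z).
- move=> k /andP[k1 kK] ka; apply/cvgrPdist_lt => e e0; apply/at_right_ex.
  have kKz : k%:Z <= K%:Z by [].
  have kT : t k%:Z < T by exact: lt_le_trans ka _.
  have k0 : 0 <= t k%:Z by have [<- _ _ _] := ht; apply: (knot_le ht); lia.
  have kk : impulse_itv T K t k%:Z (t k%:Z).
    apply/(impulse_itvE ht _ kKz); split => //; first exact: ltW.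
    by move=> k_lt; apply: (knot_lt ht); lia.
  have [d d0 dP] := impulse_itv_right ht kKz kk kT.
  have [c c0 cN] := mx_norm_le_is_norm hN.
  have cM : 0 < 1 + c * M2 by rewrite ltr_wpDr// mulr_ge0// ltW.
  exists (Num.min (Num.min d (alpha - t k%:Z)) (e / (1 + c * M2))).
    by rewrite !lt_min d0 subr_gt0 ka divr_gt0.
  move=> r /andP[kr]; rewrite -ltrBlDl !lt_min => /andP[/andP[rd ra] re].
  have kr' : impulse_itv T K t k%:Z r by apply: dP; rewrite ltW// -ltrBlDl.
  have ra' : r <= alpha by move: ra; clear_local; lra.
  apply: le_lt_trans (cN _) _.
  apply: (@le_lt_trans _ _ (c * (M2 * `|t k%:Z - r|))).
    rewrite ler_wpM2l ?(ltW c0)//; apply: (limit_x_lip kKz) => //.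
      by apply: (dom k%:Z) => //; split => //; rewrite /= in_itv/= k0 ltW.
    apply: (dom k%:Z) => //; split => //.
    by rewrite /= in_itv/= ra' (le_trans k0 (ltW kr)).
  rewrite distrC gtr0_norm ?subr_gt0// mulrA.
  apply: (@lt_trans _ _ ((1 + c * M2) * (r - t k%:Z))).
    by rewrite ltr_pM2r ?subr_gt0// ltrDr.
  by rewrite mulrC -ltr_pdivlMr.
- exact: limit_tau_continuous.
(* The right-hand side itself serves as the derivative; off the impulse times it is continuous
   because [x] and [tau] are Lipschitz there. *)
- exists (fun s => g s (x s) (tau s)).
    move=> s [s0a ns]; apply/derivative_withinP/limit_tau_expansion => //.
  apply/subspace_continuousP => s [+ ns]; rewrite /= in_itv/= => s0a.
  apply/cvgrPdist_lt => e e0; apply/within_ex.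
  have [k kK [ks [d d0 dP]]] := nonimpulse_nbhs s0a ns.
  have sT : 0 <= s <= T by case/andP: s0a => -> /le_trans; exact.
  have [d1 d10 d1P] := hyp_g_cont hN (x s) (tau s) hg sT e0.
  have c0 : 0 < 1 + M2 + M3 by rewrite ltr_wpDr// ltr_wpDr.
  exists (Num.min d (d1 / (1 + M2 + M3))); first by rewrite lt_min d0 divr_gt0.
  move=> r [+ _]; rewrite /= in_itv/= lt_min => r0a /andP[rd].
  rewrite ltr_pdivlMr// => rd1.
  have kr := dP r r0a rd.
  have xr : N (x r - x s) <= M2 * `|r - s|.
    by apply: (limit_x_lip kK) => //; apply: (dom k) => //; split => //;
      rewrite /= in_itv.
  have tr := limit_tau_lip r0a s0a.
  have rs0 : 0 <= `|r - s| by [].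
  have M2r : 0 <= M2 * `|r - s| by rewrite mulr_ge0.
  have M3r : 0 <= M3 * `|r - s| by rewrite mulr_ge0.
  rewrite distrC; apply: d1P.
  + by case/andP: r0a => -> /le_trans; exact.
  + by move: rd1 M2r M3r; clear_local; lra.
  + by move: rd1 M2r M3r xr rs0; clear_local; lra.
  + by move: rd1 M2r M3r tr rs0; clear_local; lra.
- apply: ae_imply limit_ae_regular => s h s0a; have [s0 ns nk] := h s0a.
  split; last by apply/is_deriveP; exact: limit_x_expansion.
  by have := limit_tau_ge0 (ltW (andP s0).2); move: s0a;
    clear_local => /andP[? ?] ?; lra.
- apply: ae_imply limit_ae_regular => s h s0a; have [s0 ns _] := h s0a.
  by apply/is_deriveP; apply: (@expansion_interior R R^o tau 0 alpha) => //;
    exact: limit_tau_expansion.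
- exact: limit_impulse.
- exact: limit_x_init.
- exact: limit_tau_init.
Qed.

End Existence.

(** * Ultralimits and the choice of indices *)

Section Families.
Context {R : realType} {n : nat} {N : 'rV[R]_n -> R} {T : R} {K : nat}.
Context {t : int -> R} {lambda alpha M1 M2 : R}.
Hypothesis hN : is_norm N.
Hypothesis ht : knot_sequence T K t.

(** The Lipschitz bounds before and after time 0, separate in [admissible], are put under one
    integer index, so that delayed arguments of either sign are treated alike. *)
Lemma impulse_itv_lip (F : R -> 'rV[R]_n) (k : int) s s' :
  (forall k : nat, (k <= K)%N -> forall s s' : R,
    (impulse_itv T K t k%:Z `&` `[0, alpha]) s ->
    (impulse_itv T K t k%:Z `&` `[0, alpha]) s' ->
    N (F s - F s') <= M2 * `|s - s'|) ->
  (forall (k : nat) (s s' : R),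
    (impulse_itv T K t (- k%:Z) `&` `[- M1, 0]) s ->
    (impulse_itv T K t (- k%:Z) `&` `[- M1, 0]) s' ->
    N (F s - F s') <= M2 * `|s - s'|) ->
  k <= K%:Z -> impulse_itv T K t k s -> impulse_itv T K t k s' ->
  - M1 <= s <= alpha -> - M1 <= s' <= alpha ->
  N (F s - F s') <= M2 * `|s - s'|.
Proof.
move=> Fpos Fneg; case: k => k kK ks ks' /andP[s1 sa] /andP[s1' sa'].
  have k0 r : impulse_itv T K t k r -> 0 <= r.
    move=> /(impulse_itvE ht _ kK)[kr _ _]; apply: le_trans kr.
    by have [<- _ _ _] := ht; apply: (knot_le ht); lia.
  have kK' : (k <= K)%N by exact: kK.
  apply: (Fpos k kK').
    by split => //; rewrite /= in_itv/= sa k0.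
  by split => //; rewrite /= in_itv/= sa' k0.
rewrite NegzE in kK ks ks'.
have k0 r : impulse_itv T K t (- k.+1%:Z) r -> r <= 0.
  move=> /(impulse_itvE ht _ kK)[_ _ rk].
  have /ltW/le_trans -> // : r < t (- k.+1%:Z + 1) by apply: rk; lia.
  by have [<- _ _ _] := ht; apply: (knot_le ht); lia.
apply: (Fneg k.+1); split => //; rewrite /= in_itv/=.
  by rewrite s1 k0.
by rewrite s1' k0.
Qed.

Lemma last_knot_before_ex : 0 < alpha <= T -> ~ impulse_times K t alpha ->
  exists k0, last_knot_before K t alpha k0.
Proof.
move=> /andP[a0 aT] na; have [k' kK [ka kmax]] := knot_last ht alpha.
have t0 : t 0 = 0 by case: ht.
have k0 : 0 <= k' by apply: kmax; rewrite // t0 ltW.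
case: k' k0 kK ka kmax => // k _ kK ka kmax; exists k; split => //.
  rewrite lt_neqAle ka andbT; apply/eqP => kE.
  case: (posnP k) => [k0|k1]; first by move: a0; rewrite -kE k0 t0 ltxx.
  by apply: na; exists k => //; rewrite k1.
by move=> j jK ja; have := kmax j%:Z jK (ltW ja).
Qed.

Lemma history_index_ex : 0 < lambda -> exists2 l0 : nat, (0 < l0)%N &
  history_index t lambda l0.
Proof.
move=> lam0; have [k kK [kl kmax]] := knot_last ht (- lambda).
have t0 : t 0 = 0 by case: ht.
have k0 : k < 0.
  rewrite ltNge; apply/negP => k0; have kK1 : k <= K%:Z + 1 by lia.
  have := le_trans (knot_le ht k0 kK1) kl.
  by rewrite t0 oppr_ge0 leNgt lam0.
exists `|k|%N; first lia.
rewrite /history_index (_ : - `|k|%N%:Z = k) ?kl/=; last lia.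
rewrite ltNge; apply/negP => kl'; have := kmax (k + 1) _ kl'; lia.
Qed.

(** Each [J_itv] lies in one interval between knots and in [[- M1, alpha]]: cutting at [- lambda]
    respects the lower bound since [lambda <= M1]. *)
Lemma J_itv_lip (F : R -> 'rV[R]_n) (k0 l0 : nat) :
  0 < lambda <= M1 -> alpha <= T -> ~ impulse_times K t alpha ->
  (forall (k : int) s s', k <= K%:Z ->
    impulse_itv T K t k s -> impulse_itv T K t k s' ->
    - M1 <= s <= alpha -> - M1 <= s' <= alpha ->
    N (F s - F s') <= M2 * `|s - s'|) ->
  last_knot_before K t alpha k0 -> (0 < l0)%N -> history_index t lambda l0 ->
  forall k : int, - l0%:Z <= k <= k0%:Z -> forall s s' : R,
    J_itv t lambda alpha k0 l0 k s -> J_itv t lambda alpha k0 l0 k s' ->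
    N (F s - F s') <= M2 * `|s - s'|.
Proof.
move=> /andP[lam0 lamM] aT na Flip [k0K k0a k0max] l0_gt0 /andP[hl hl'] k.
move=> /andP[lk kk0] s s'.
have t0 : t 0 = 0 by case: ht.
have kK : k <= K%:Z by lia.
suff sub r : J_itv t lambda alpha k0 l0 k r ->
    impulse_itv T K t k r /\ - M1 <= r <= alpha.
  by move=> /sub[ks sd] /sub[ks' sd']; exact: (Flip k).
have knotE : t k <= modified_knot t lambda alpha k0 l0 k /\
    - M1 <= modified_knot t lambda alpha k0 l0 k.
  rewrite /modified_knot; case: eqP => [->|kl].
    by rewrite hl lerN2 lamM.
  rewrite ifF; last by apply/negP => /eqP; lia.
  split => //; apply: (@le_trans _ _ (t (- l0%:Z + 1))).
    by apply: le_trans (ltW hl'); rewrite lerN2.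
  by apply: (knot_le ht); lia.
case: knotE => tk M1k; rewrite /J_itv.
case: ifPn => [kk|].
  have -> : modified_knot t lambda alpha k0 l0 (k + 1) = t (k + 1).
    rewrite /modified_knot ifF; last by apply/negP => /eqP; lia.
    by rewrite ifF//; apply/negP => /eqP; lia.
  rewrite /= in_itv/= => /andP[kr rk].
  have kT : t (k + 1) <= alpha.
    by apply: le_trans (ltW k0a); apply: (knot_le ht); lia.
  split; last by rewrite (le_trans M1k kr) (le_trans (ltW rk) kT).
  apply/(impulse_itvE ht _ kK); split => //; first exact: le_trans kr.
  exact: le_trans (le_trans (ltW rk) kT) aT.
rewrite -leNgt => kk; have kE : k = k0%:Z by lia.
subst k; rewrite /= in_itv/= => /andP[kr ra].
split; last by rewrite ra (le_trans M1k kr).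
apply/(impulse_itvE ht _ kK); split; [exact: le_trans kr|exact: le_trans aT|].
(* By maximality of [k0] the next knot is not before [alpha], and equality would make [alpha] an
   impulse time. *)
move=> k_lt; apply: (le_lt_trans ra); rewrite ltNge; apply/negP => ka.
have k0K' : (k0.+1 <= K)%N by exact: k_lt.
have kE : k0%:Z + 1 = k0.+1%:Z by lia.
have := k0max k0.+1 k0K'; rewrite ltnn -kE lt_neqAle ka andbT => h.
case: (eqVneq (t (k0%:Z + 1)) alpha) => [tE|tn]; last by have := h tn.
by apply: na; exists k0.+1; rewrite ?k0K' // -tE kE.
Qed.

End Families.

Section UltraLimit.
Context {R : realType} {n : nat} {N : 'rV[R]_n -> R} {alpha hstar M1 : R}.
Context {X : R -> R -> 'rV[R]_n} {Y : R -> R -> R}.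
Hypothesis hN : is_norm N.
Hypothesis hstar_gt0 : 0 < hstar.
Hypothesis Y_ge0 : forall h s : R, 0 < h < hstar -> s <= alpha -> 0 <= Y h s.
Hypothesis XY_lt : forall h s : R, 0 < h < hstar -> s <= alpha ->
  N (X h s) + Y h s < M1.

(** At each time the values stay in a compact set, so they converge along one ultrafilter fixed for
    all times. A finite list of times requires only a finite intersection of its members, which is
    nonempty. *)
Lemma ultra_approximation : exists (x : R -> 'rV[R]_n) (tau : R -> R),
  forall (l : seq R) (d e : R), 0 < d -> 0 < e ->
  (forall s, s \in l -> s <= alpha) ->
  exists h : R, [/\ h < d, 0 < h < hstar &
    forall s, s \in l -> N (X h s - x s) < e /\ `|Y h s - tau s| < e].
Proof.
have [U [UU sU]] := ultraFilterLemma (at_right_proper_filter (0 : R)).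
have small d : 0 < d -> \forall h \near U, 0 < h < d.
  move=> d0; apply: sU; apply/at_right_ex; exists d => // r.
  by rewrite add0r.
have [c c0 cN] := mx_norm_le_is_norm hN.
have [C C0 NC] := is_norm_le_mx_norm hN.
have N0 u : 0 <= N u := is_norm_ge0 hN u.
have Xcvg s : s <= alpha -> cvg (X h s @[h --> U]).
  move=> sa; have cB := @compact_closed_ball0 R n (c * M1).
  apply: (@ultra_compact_cvg _ 'rV[R]_n _ _ _ UU cB).
  apply: filterS (small _ hstar_gt0) => h hh.
  apply: le_trans (cN _) _; rewrite ler_wpM2l ?(ltW c0)//.
  by apply: le_trans (ltW (XY_lt hh sa)); rewrite lerDl Y_ge0.
have Ycvg s : s <= alpha -> cvg (Y h s @[h --> U]).
  move=> sa; apply: (ultra_compact_cvg UU (@segment_compact _ 0 M1)).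
  apply: filterS (small _ hstar_gt0) => h hh; rewrite /= in_itv/= Y_ge0//=.
  by apply: le_trans (ltW (XY_lt hh sa)); rewrite lerDr.
exists (fun s => lim (X h s @[h --> U])), (fun s => lim (Y h s @[h --> U])).
move=> l d e d0 e0 la.
have near_l : \forall h \near U, forall s, s \in l ->
    N (X h s - lim (X h s @[h --> U])) < e /\
    `|Y h s - lim (Y h s @[h --> U])| < e.
  elim: l la => [|a l IH] la; first by apply: nearW => h s; rewrite in_nil.
  have aa : a <= alpha by apply: la; rewrite mem_head.
  have eC : 0 < e / C by rewrite divr_gt0.
  have hl : \forall h \near U, forall s, s \in l ->
      N (X h s - lim (X h s @[h --> U])) < e /\
      `|Y h s - lim (Y h s @[h --> U])| < e.
    by apply: IH => s sl; apply: la; rewrite in_cons sl orbT.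
  have hX : \forall h \near U, `|lim (X h a @[h --> U]) - X h a| < e / C.
    by move/cvgrPdist_lt : (Xcvg a aa); exact.
  have hY : \forall h \near U, `|lim (Y h a @[h --> U]) - Y h a| < e.
    by move/cvgrPdist_lt : (Ycvg a aa); exact.
  apply: filterS3 hl hX hY => h hl hX hY s.
  rewrite in_cons => /orP[/eqP ->|/hl//]; split; last by rewrite distrC.
  by apply: le_lt_trans (NC _) _; rewrite mulrC -ltr_pdivlMr// distrC.
have m0 : 0 < Num.min d hstar by rewrite lt_min d0.
have [h [/andP[h0]]] := filter_ex (filterI (small _ m0) near_l).
by rewrite lt_min => /andP[hd hh] hl; exists h; rewrite hd h0.
Qed.

End UltraLimit.

Theorem theorem3 (R : realType) (n : nat) (N : 'rV[R]_n -> R) (hN : is_norm N)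
    (T : R) (hT : 0 < T) (K : nat) (t : int -> R)
    (ht : knot_sequence T K t)
    (f : R -> 'rV[R]_n -> 'rV[R]_n -> 'rV[R]_n)
    (g : R -> 'rV[R]_n -> R -> R)
    (I : nat -> 'rV[R]_n -> 'rV[R]_n)
    (phi : R -> 'rV[R]_n) (lambda : R) (hlambda : 0 < lambda)
    (hf : hyp_f N T f) (hg : hyp_g N T g) (hI : hyp_I N K I)
    (hphi : hyp_phi N t phi)
    (alpha hstar M1 M2 M3 : R)
    (hadm : admissible N T K t f g I phi lambda alpha hstar M1 M2 M3)
    (hg1 : forall (s : R) (u : 'rV[R]_n) (w : R),
       0 <= s <= alpha -> N u <= M1 -> 0 <= w <= M1 -> g s u w < 1) :
  exists (x : R -> 'rV[R]_n) (tau : R -> R),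
    unique_upto alpha (solution N T K t f g I phi lambda alpha) x tau /\
    [/\ forall s : R, 0 <= s <= alpha -> 0 < tau s,
        forall s : R, s <= alpha -> N (x s) + tau s <= M1,
        exists k0 l0 : nat,
          [/\ last_knot_before K t alpha k0, history_index t lambda l0 &
            forall k : int, - l0%:Z <= k <= k0%:Z -> forall s s' : R,
              J_itv t lambda alpha k0 l0 k s ->
              J_itv t lambda alpha k0 l0 k s' ->
              N (x s - x s') <= M2 * `|s - s'|]
      & forall s s' : R, 0 <= s <= alpha -> 0 <= s' <= alpha ->
          `|tau s - tau s'| <= M3 * `|s - s'|].
Proof.
have [alphaT na /andP[hstar0 _] [M10 M20 M30] hsch] := hadm.
have aT : alpha <= T by case/andP: alphaT.
have /choice[F FP] : forall h : R, exists F : (R -> 'rV[R]_n) * (R -> R),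
  0 < h < hstar ->
  scheme_solution T K t f g I phi lambda alpha h F.1 F.2 /\
  [/\ forall s : R, 0 <= s <= alpha -> 0 < F.2 s,
      forall s : R, s <= alpha -> N (F.1 s) + F.2 s < M1,
      forall (k : int) s s', k <= K%:Z ->
        impulse_itv T K t k s -> impulse_itv T K t k s' ->
        - M1 <= s <= alpha -> - M1 <= s' <= alpha ->
        N (F.1 s - F.1 s') <= M2 * `|s - s'|
    & forall s s' : R, 0 <= s <= alpha -> 0 <= s' <= alpha ->
        `|F.2 s - F.2 s'| <= M3 * `|s - s'|].
  (* Outside [(0, hstar)] the pair of zero functions is a default value. *)
  move=> h; have [hh|nh] := pselect (0 < h < hstar);
    last by exists (fun=> 0, fun=> 0).
  have [x [tau [[xs _] [tp xM xpos xneg tl]]]] := hsch h hh.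
  exists (x, tau) => _; split => //; split => // k s s'.
  exact: (impulse_itv_lip ht xpos xneg).
pose X h := (F h).1; pose Y h := (F h).2.
have Ys h hh := (FP h hh).1.
have Y0 h s : 0 < h < hstar -> s <= alpha -> 0 <= Y h s.
  move=> hh sa; have [sch [tp _ _ _]] := FP h hh.
  have [s0|/ltW s0] := leP 0 s; first by apply/ltW/tp; rewrite s0.
  by rewrite /Y (sch_tau_init sch s0) ltW.
have XYM h s : 0 < h < hstar -> s <= alpha -> N (X h s) + Y h s < M1.
  by move=> hh; have [_ [_ + _ _]] := FP h hh; exact.
have [x [tau approx]] := ultra_approximation hN hstar0 Y0 XYM.
have sch h (hh : 0 < h < hstar) := (FP h hh).1.
have Yp h : 0 < h < hstar -> forall s, 0 <= s <= alpha -> 0 < Y h s.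
  by move=> hh; have [_ []] := FP h hh.
have XYM' h : 0 < h < hstar -> forall s, s <= alpha -> N (X h s) + Y h s < M1.
  by move=> hh s; exact: XYM.
have Xl h : 0 < h < hstar -> forall (k : int) s s', k <= K%:Z ->
    impulse_itv T K t k s -> impulse_itv T K t k s' ->
    - M1 <= s <= alpha -> - M1 <= s' <= alpha ->
    N (X h s - X h s') <= M2 * `|s - s'|.
  by move=> hh; have [_ []] := FP h hh.
have Yl h : 0 < h < hstar -> forall s s', 0 <= s <= alpha -> 0 <= s' <= alpha ->
    `|Y h s - Y h s'| <= M3 * `|s - s'|.
  by move=> hh; have [_ []] := FP h hh.
have xs := limit_solution hN ht hf hg hI hlambda alphaT M20 M30 hg1 sch Yp XYM'
  Xl Yl approx.
have tau0 : forall s, 0 <= s <= alpha -> 0 < tau s.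
  by move=> s; apply: (limit_tau_gt0 hN ht hg hlambda alphaT M20 M30 sch Yp XYM'
    Xl Yl approx).
have xM : forall s, s <= alpha -> N (x s) + tau s <= M1.
  by move=> s; apply: (limit_bound hN XYM' approx).
have xlip := limit_x_lip hN Xl approx.
exists x, tau; split; [|split => //].
- split => // y sigma ys s sa.
  exact: (solution_unique hN ht hf hg alphaT hg1 xs tau0 xM M20 xlip ys sa).
- have [k0 k0P] := last_knot_before_ex ht alphaT na.
  have [l0 l00 l0P] := history_index_ex ht hlambda.
  exists k0, l0; split => //; apply: (J_itv_lip ht _ aT na xlip k0P l00 l0P).
  (* The bound [lambda <= M1] is read off at time 0, where [tau 0 = lambda]. *)
  rewrite hlambda -(sol_tau_init xs (lexx 0)).
  have a0 : 0 <= alpha by case/andP: alphaT => /ltW.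
  by apply: le_trans (xM 0 a0); rewrite lerDr (is_norm_ge0 hN).
- by move=> s s' s0 s0'; apply: (limit_tau_lip Yl approx).
Qed.
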